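(* Let $\rho>0$. Under equal bandwidth allocation to all users and the first-order correlation model, the rate coverage of the typical user in the 2D network is $$\mathrm{r_c}(\rho)=\mathbb P[B_{\mathrm u}\log_2(1+\mathsf{SINR})>\rho]=\mathbb P\Big[\mathsf{SINR}>2^{\rho N_{\mathrm u}/B}-1\Big]=\mathrm{p_c}\big(2^{\rho N_{\mathrm u}/B}-1\big),$$ where $$\mathrm{p_c}(\tau)=\sum_{s\in\{\mathsf L,\mathsf N\}}\int_0^\infty 2\pi\lambda\,e^{-\tau\sigma_n^2/\ell_s(r)}\,\kappa_{\mathsf L|s}(r,\tau)\,\kappa_{\mathsf N|s}(r,\tau)\,g_s(r)\,r\,dr,$$ $$\kappa_{v|s}(r,\tau)=\exp\Big(-\int_{e_{v|s}(r)}^\infty\frac{\lambda}{1+\tau^{-1}\frac{\ell_s(r)}{\ell_v(t)}}\Big(\int_0^{2\pi}\frac{p_{s,v}(r,t,\theta)}{p_s(r)}\,d\theta\Big)t\,dt\Big),$$ $$g_{\mathsf L}(x)=p_{\mathsf L}(x)\exp\Big(-\lambda\int_0^{2\pi}\int_0^{x}\frac{p_{\mathsf L,\mathsf L}(x,t,\theta)}{p_{\mathsf L}(x)}t\,dt\,d\theta-\lambda\int_0^{2\pi}\int_0^{e_{\mathsf N|\mathsf L}(x)}\frac{p_{\mathsf L,\mathsf N}(x,t,\theta)}{p_{\mathsf L}(x)}t\,dt\,d\theta\Big),$$ $$g_{\mathsf N}(x)=p_{\mathsf N}(x)\exp\Big(-\lambda\int_0^{2\pi}\int_0^{e_{\mathsf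 L|\mathsf N}(x)}\frac{p_{\mathsf N,\mathsf L}(x,t,\theta)}{p_{\mathsf N}(x)}t\,dt\,d\theta-\lambda\int_0^{2\pi}\int_0^{x}\frac{p_{\mathsf N,\mathsf N}(x,t,\theta)}{p_{\mathsf N}(x)}t\,dt\,d\theta\Big).$$
   Context: 2D network. Base stations (BSs) form a homogeneous Poisson point process (PPP) of density $\lambda>0$ on $\mathbb R^2$; the typical user is at the origin. Blockages form an independent Boolean model of line segments: centers form a homogeneous PPP of density $\mu>0$, with i.i.d. random lengths $L$ ($0<\mathbb E[L]<\infty$) and independent orientations uniform on $[0,\pi]$; $\beta=2\mu\mathbb E[L]/\pi$. A link is the segment from the origin to a BS; it is LoS (type $\mathsf L$) if no blockage intersects it and NLoS (type $\mathsf N$) otherwise. A link of length $r$ is LoS with probability $p_{\mathsf L}(r)=e^{-\beta r}$ and NLoS with probability $p_{\mathsf N}(r)=1-e^{-\beta r}$. For two links of lengths $r_1,r_2$ with directions differing by $\theta\in[0,2\pi]$, $p_{s,v}(r_1,r_2,\theta)$ is the probability that the first is of type $s$ and the second of type $v$; thus $p_{\mathsf L,\mathsf L}$ is the probability that no blockage intersects either link, $p_{\mathsf L,\mathsf N}=e^{-\beta r_1}-p_{\mathsf L,\mathsf L}$, $p_{\mathsf N,\mathsf L}=e^{-\beta r_2}-p_{\mathsf L,\mathsf L}$, $p_{\mathsf N,\mathsf N}=1-e^{-\beta r_1}-e^{-\beta r_2}+p_{\mathsf L,\mathsf L}$. Path loss: $\ell_{\mathsf L},\ell_{\mathsf N}:[0,\infty)\to[0,\infty)$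 are bounded and nonincreasing with $\ell_{\mathsf L}\ge\ell_{\mathsf N}$. A BS of type $v$ at distance $t$ gives received power $H\ell_v(t)$, with fading $H$ i.i.d. exponential of mean $1$, independent of everything else. Exclusion radii: $e_{\mathsf L|\mathsf L}(x)=e_{\mathsf N|\mathsf N}(x)=x$, $e_{\mathsf N|\mathsf L}(x)=\min\{y\ge0:\ell_{\mathsf N}(y)\le\ell_{\mathsf L}(x)\}$, $e_{\mathsf L|\mathsf N}(x)=\min\{y\ge0:\ell_{\mathsf L}(y)\le\ell_{\mathsf N}(x)\}$ (min read as infimum, $\infty$ if the set is empty). A BS of type $s$ at distance $x$ is serving iff every other BS of type $v$ is at distance greater than $e_{v|s}(x)$, for $v\in\{\mathsf L,\mathsf N\}$. When a BS of type $s$ at distance $r$ with fading $H_0$ is serving, $\mathsf{SINR}=H_0\ell_s(r)/(\sigma_n^2+I)$, where $\sigma_n^2>0$ is the noise power and $I$ is the sum of received powers of all other BSs. First-order correlation model: for $r>0$, let $Q_r$ be the law in which there is a given BS at distance $r$, of type $s$ with probability $p_s(r)$; given that it is of type $s$, the other BSs form a PPP of density $\lambda$ and their types are mutually independent, a BS at distance $t$ whose direction makes angle $\theta$ with that of the given BS having type $v$ with probability $p_{s,v}(r,t,\theta)/p_s(r)$. Let $E_{s,r}$ be the event that the given BS is of type $s$ and is serving. In the first-order model the Palm distribution given a BS at distance $r$ is taken to be $Q_r$, so for any event $\mathcal A$ about the SINR, $\mathbb P[\mathcal A]=\sum_s 2\pi\lambda\int_0^\infty Q_r[E_{s,r}\cap\mathcal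 A]\,r\,dr$; $\mathrm{p_c}(\tau)=\mathbb P[\mathsf{SINR}>\tau]$. Rate: $\mathsf{Rate}=B_{\mathrm u}\log_2(1+\mathsf{SINR})$ and $\mathrm{r_c}(\rho)=\mathbb P[\mathsf{Rate}>\rho]$. Equal allocation: $B_{\mathrm u}=B/N_{\mathrm u}$, with $B>0$ the system bandwidth and $N_{\mathrm u}=1+1.28\,\lambda_{\mathrm u}/\lambda$ the (deterministic) mean number of users connected to the serving BS, $\lambda_{\mathrm u}$ being the user density. Conventions: $1/(1+\tau^{-1}a/b)=0$ when $b=0$, and the integrand containing $e^{-\tau\sigma_n^2/\ell_s(r)}$ is $0$ when $\ell_s(r)=0$. *)

(* Defs.v *)
From HB Require Import structures.
From mathcomp Require Import all_boot all_order all_algebra.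
From mathcomp Require Import all_classical all_reals all_analysis.

Set Implicit Arguments.
Unset Strict Implicit.
Unset Printing Implicit Defensive.

Import Order.TTheory GRing.Theory Num.Theory.
Import numFieldNormedType.Exports.

Local Open Scope classical_set_scope.
Local Open Scope ring_scope.

Definition area (R : realType) : set (R * R) -> \bar R :=
  (@lebesgue_measure R \x @lebesgue_measure R)%E.

Definition dist (R : realType) (x : R * R) : R :=
  Num.sqrt (x.1 ^+ 2 + x.2 ^+ 2).

Definition polar (R : realType) (t theta : R) : R * R :=
  (t * cos theta, t * sin theta).

(* The polar angle in [0, 2 pi[, so that x = polar (dist x) (angle x).  At the
   origin the value is irrelevant: a Poisson process almost surely has no point
   there. *)
Definition angle (R : realType) (x : R * R) : R :=
  let a := acos (x.1 / dist x) in if 0 <= x.2 then a else 2 * pi - a.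

Definition log2 (R : realType) (x : R) : R := ln x / ln 2.

(* A point process on the plane is given by a sequence (X_n) of random points,
   in an arbitrary measurable enumeration; processes of positive density on the
   whole plane are almost surely infinite, so nothing is lost. *)
Definition count_points (R : realType) (T : Type) (X : nat -> T -> R * R)
    (A : set (R * R)) (w : T) : \bar R :=
  (\sum_(n <oo) (\1_A (X n w))%:E)%E.

(* Homogeneous Poisson point process: the numbers of points in disjoint sets of
   finite area are independent Poisson variables of mean density * area.
   The library's poisson_pmf is not used: at rate 0 it is constantly 1. *)
Definition is_ppp (R : realType) (d : measure_display) (T : measurableType d)
    (P : probability T R) (density : R) (X : nat -> T -> R * R) : Prop :=
  forall (k : nat) (A : 'I_k -> set (R * R)) (m : 'I_k -> nat),
    (forall i, measurable (A i)) ->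
    (forall i, (area (A i) < +oo)%E) ->
    (forall i j, i != j -> A i `&` A j = set0) ->
    P [set w | forall i, count_points X (A i) w = (m i)%:R%:E] =
    (\prod_(i < k)
      (let a := density * fine (area (A i)) in
       a ^+ m i / (m i)`!%:R * expR (- a)))%:E.

Definition sigma_seq (T : Type) (d : measure_display) (U : measurableType d)
    (X : nat -> T -> U) : set (set T) :=
  \bigcup_n preimage_set_system setT (X n) measurable.

(* Poisson process whose points carry marks that are mutually independent
   conditionally on the positions, a point at x having mark law K x. *)
Definition is_marked_ppp (R : realType) (d dM : measure_display)
    (T : measurableType d) (U : measurableType dM) (P : probability T R)
    (density : R) (X : nat -> T -> R * R) (M : nat -> T -> U)
    (K : R * R -> set U -> \bar R) : Prop :=
  is_ppp P density X /\
  forall (n : nat) (G : set T) (D : 'I_n -> set U),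
    <<s sigma_seq X >> G -> (forall i, measurable (D i)) ->
    P (G `&` [set w | forall i : 'I_n, D i (M i w)]) =
    (\int[P]_(w in G) \prod_(i < n) K (X i w) (D i))%E.

Definition cond_prob (R : realType) (d : measure_display)
    (T : measurableType d) (P : probability T R) (G : set T)
    (mG : measurable G) : probability T R :=
  mnormalize (mrestr P mG) P.

Notation LoS := true (only parsing).
Notation NLoS := false (only parsing).

(* The mark of a blockage is its pair (length, orientation). *)
Record blockages (R : realType) (d : measure_display)
    (T : measurableType d) := Blockages {
  bl_center : nat -> {mfun T >-> (R * R)%type};
  bl_mark : nat -> {mfun T >-> (R * R)%type} }.

Definition is_boolean_model (R : realType) (d : measure_display)
    (T : measurableType d) (P : probability T R) (mu : R)
    (len : probability R R) (b : blockages R T) : Prop :=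
  is_marked_ppp P mu (bl_center b) (bl_mark b)
    (fun _ => (len \x uniform_prob (pi_gt0 R))%E).

Definition blockage_segment (R : realType) (c m : R * R) : set (R * R) :=
  [set (c.1 + u * cos m.2, c.2 + u * sin m.2) | u in `[- (m.1 / 2), m.1 / 2]].

Definition link_segment (R : realType) (x : R * R) : set (R * R) :=
  [set (u * x.1, u * x.2) | u in `[0, 1]].

Definition link_event (R : realType) (d : measure_display)
    (T : measurableType d) (b : blockages R T) (v : bool) (x : R * R) : set T :=
  let los := [set w | forall n,
    link_segment x `&` blockage_segment (bl_center b n w) (bl_mark b n w)
      = set0] in
  if v then los else ~` los.

(* By isotropy of the blockages only the angle between the links matters; the
   first link is taken along the first axis. *)
Definition joint_prob (R : realType) (d : measure_display)
    (T : measurableType d) (P : probability T R) (b : blockages R T)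
    (s v : bool) (r1 r2 theta : R) : R :=
  fine (P (link_event b s (polar r1 0) `&` link_event b v (polar r2 theta))).

Definition blockage_rate (R : realType) (mu : R) (len : probability R R) : R :=
  2 * mu * fine (\int[len]_l l%:E)%E / pi.

Definition link_prob (R : realType) (beta : R) (s : bool) (r : R) : R :=
  if s then expR (- (beta * r)) else 1 - expR (- (beta * r)).

(* e_{v|s}(x); the infimum of the empty set is +oo. *)
Definition excl (R : realType) (ell : bool -> R -> R) (v s : bool) (x : R)
    : \bar R :=
  if v == s then x%:E
  else ereal_inf [set y%:E | y in [set y : R | 0 <= y /\ ell v y <= ell s x]].

(* The given base station (type and fading) and the other ones; the mark of
   another base station is its pair (type, fading). *)
Record stations (R : realType) (d : measure_display)
    (T : measurableType d) := Stations {
  bs_type : {mfun T >-> bool};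
  bs_fading : {mfun T >-> R};
  ot_pos : nat -> {mfun T >-> (R * R)%type};
  ot_mark : nat -> {mfun T >-> (bool * R)%type} }.

Definition type_event (R : realType) (d : measure_display)
    (T : measurableType d) (c : stations R T) (s : bool) : set T :=
  bs_type c @^-1` [set s].

Lemma measurable_type_event (R : realType) (d : measure_display)
  (T : measurableType d) (c : stations R T) (s : bool) :
  measurable (type_event c s).
Proof. exact: measurable_funPTI. Qed.

(* Law of the mark of another base station at x, when the given one, at
   distance r on the positive first axis, has type s: the type is v with
   probability p_{s,v}(r, dist x, angle x) / p_s(r), and the fading is an
   independent exponential variable of mean 1. *)
Definition station_kernel (R : realType) (p : bool -> R -> R)
    (pj : bool -> bool -> R -> R -> R -> R) (s : bool) (r : R) (x : R * R)
    (D : set (bool * R)) : \bar R :=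
  (\sum_(v : bool) (pj s v r (dist x) (angle x) / p s r)%:E *
    exponential_prob 1 [set h | D (v, h)])%E.

(* Q r is the law Q_r, r > 0, of the same random elements on a common space. *)
Record first_order_model (R : realType) (d : measure_display)
    (T : measurableType d) (lambda : R) (p : bool -> R -> R)
    (pj : bool -> bool -> R -> R -> R -> R)
    (c : stations R T) (Q : R -> probability T R) : Prop := {
  fom_type : forall r s, 0 < r -> Q r (type_event c s) = (p s r)%:E;
  fom_others : forall r s, 0 < r ->
    is_marked_ppp (cond_prob (Q r) (measurable_type_event c s)) lambda
      (ot_pos c) (ot_mark c) (station_kernel p pj s r);
  fom_fading : forall r (D : set R) (G : set T), 0 < r -> measurable D ->
    <<s preimage_set_system setT (bs_type c) measurable `|`
        sigma_seq (ot_pos c) `|` sigma_seq (ot_mark c) >> G ->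
    Q r ((bs_fading c @^-1` D) `&` G) = (exponential_prob 1 D * Q r G)%E;
  fom_fading_ge0 : forall w, 0 <= bs_fading c w;
  fom_fadings_ge0 : forall n w, 0 <= (ot_mark c n w).2 }.

Definition serving_event (R : realType) (d : measure_display)
    (T : measurableType d) (ell : bool -> R -> R) (c : stations R T)
    (s : bool) (r : R) : set T :=
  type_event c s `&`
  [set w | forall n,
    (excl ell (ot_mark c n w).1 s r < (dist (ot_pos c n w))%:E)%E].

Definition interference (R : realType) (d : measure_display)
    (T : measurableType d) (ell : bool -> R -> R) (c : stations R T)
    (w : T) : \bar R :=
  (\sum_(n <oo)
    ((ot_mark c n w).2 * ell (ot_mark c n w).1 (dist (ot_pos c n w)))%:E)%E.

(* The interference may be infinite, in which case the SINR is 0. *)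
Definition sinr (R : realType) (d : measure_display)
    (T : measurableType d) (ell : bool -> R -> R) (sigma2 : R)
    (c : stations R T) (s : bool) (r : R) (w : T) : R :=
  fine ((bs_fading c w * ell s r)%:E / (sigma2%:E + interference ell c w))%E.

(* P[SINR \in A], where Q r stands for the Palm distribution given a station at
   distance r. *)
Definition fo_prob (R : realType) (d : measure_display)
    (T : measurableType d) (lambda : R) (ell : bool -> R -> R) (sigma2 : R)
    (c : stations R T) (Q : R -> probability T R) (A : set R) : \bar R :=
  (\sum_(s : bool) (2 * pi * lambda)%:E *
    \int[@lebesgue_measure R]_(r in `]0%R, +oo[)
      (Q r (serving_event ell c s r `&` [set w | A (sinr ell sigma2 c s r w)])
       * r%:E))%E.

Definition sinr_coverage (R : realType) (d : measure_display)
    (T : measurableType d) (lambda : R) (ell : bool -> R -> R) (sigma2 : R)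
    (c : stations R T) (Q : R -> probability T R) (tau : R) : \bar R :=
  fo_prob lambda ell sigma2 c Q [set x | tau < x].

Definition mean_users (R : realType) (lambda lambda_u : R) : R :=
  1 + 128%:R / 100%:R * (lambda_u / lambda).

Definition user_rate (R : realType) (Bu x : R) : R := Bu * log2 (1 + x).

Definition rate_coverage (R : realType) (d : measure_display)
    (T : measurableType d) (lambda : R) (ell : bool -> R -> R) (sigma2 : R)
    (c : stations R T) (Q : R -> probability T R) (Bu rho : R) : \bar R :=
  fo_prob lambda ell sigma2 c Q [set x | rho < user_rate Bu x].

Definition interf_factor (R : realType) (tau a b : R) : R :=
  if b == 0 then 0 else (1 + tau^-1 * (a / b))^-1.

Definition kappa (R : realType) (lambda : R) (ell : bool -> R -> R)
    (p : bool -> R -> R) (pj : bool -> bool -> R -> R -> R -> R)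
    (v s : bool) (r tau : R) : \bar R :=
  expeR (- \int[@lebesgue_measure R]_(t in [set t | (excl ell v s r <= t%:E)%E])
    ((lambda * interf_factor tau (ell s r) (ell v t))%:E *
     (\int[@lebesgue_measure R]_(theta in `[0%R, (2 * pi)%R])
        (pj s v r t theta / p s r)%:E) * t%:E))%E.

Definition void_exponent (R : realType) (lambda : R) (ell : bool -> R -> R)
    (p : bool -> R -> R) (pj : bool -> bool -> R -> R -> R -> R)
    (v s : bool) (x : R) : \bar R :=
  (lambda%:E * \int[@lebesgue_measure R]_(theta in `[0%R, (2 * pi)%R])
    \int[@lebesgue_measure R]_(t in [set t | (0 <= t)%R /\
                                    (t%:E <= excl ell v s x)%E])
      (pj s v x t theta / p s x * t)%:E)%E.

(* For each s, one of the two radii excl ell v s x is x itself. *)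
Definition serving_density (R : realType) (lambda : R) (ell : bool -> R -> R)
    (p : bool -> R -> R) (pj : bool -> bool -> R -> R -> R -> R)
    (s : bool) (x : R) : \bar R :=
  ((p s x)%:E * expeR (- void_exponent lambda ell p pj LoS s x
                       - void_exponent lambda ell p pj NLoS s x))%E.

Definition noise_factor (R : realType) (sigma2 tau a : R) : R :=
  if a == 0 then 0 else expR (- (tau * sigma2 / a)).

Definition coverage_formula (R : realType) (lambda : R)
    (ell : bool -> R -> R) (sigma2 : R) (p : bool -> R -> R)
    (pj : bool -> bool -> R -> R -> R -> R) (tau : R) : \bar R :=
  (\sum_(s : bool)
    \int[@lebesgue_measure R]_(r in `]0%R, +oo[)
      ((2 * pi * lambda * noise_factor sigma2 tau (ell s r))%:E *
       kappa lambda ell p pj LoS s r tau * kappa lambda ell p pj NLoS s r tau *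
       serving_density lambda ell p pj s r * r%:E))%E.

(* Main.v *)
Require Import Defs.
From HB Require Import structures.
From mathcomp Require Import all_boot all_order all_algebra ring lra.
From mathcomp Require Import all_classical all_reals all_analysis.
From mathcomp Require Import finmap measurable_realfun.

Set Implicit Arguments.
Unset Strict Implicit.
Unset Printing Implicit Defensive.

Import Order.TTheory GRing.Theory Num.Theory.
Import numFieldNormedType.Exports.

Local Open Scope classical_set_scope.
Local Open Scope ring_scope.

(** Conditionally on the serving station, of type [s] at distance [r], its
exponential fading [H0] exceeds [tau (sigma2 + I) / ell_s(r)] with probability
[exp (- tau (sigma2 + I) / ell_s(r))], so that the coverage probability is the
noise factor times the expectation of
[1{every other station is far enough} exp (- tau I / ell_s(r))].  This is the
expectation of a product over the other stations; integrating out the marks, one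
station at a time, leaves [prod_n (1 - u (X_n))], where
[1 - u(x) = sum_v q_v(x) 1{e_{v|s}(r) < |x|} / (1 + tau ell_v(|x|) / ell_s(r))]
and [q_v(x)] is the conditional probability that a station at [x] has type [v].
Its expectation is [exp (- lambda int u)]: for a simple function [u] this is the
generating function of independent Poisson variables, and monotone limits give
the general case.  In polar coordinates [int u] splits at [t = e_{v|s}(r)]; the
inner part gives [g_s], where [u] is the probability of the type, and the outer
part gives the factors [kappa_{v|s}]. *)

(** The hypotheses give probabilities of finite product events only, whereas the interference
    involves infinitely many stations. Expectations are therefore taken of products over the first n
    stations, with values in [0, 1]; dominated convergence lets n tend to infinity, and since these
    products decrease in n and in u, the limit in n and the approximation of u are exchanged as two
    infima. The passage from product events to functions, for counts as for marks, uses a mixed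
    product whose first j factors are functions and whose other factors are indicators, with
    induction on j. The conditional type probabilities at x add up to the probability that the given
    link has type s, divided by p_s(r); this does not depend on x, and it is 1 because the mark law
    has total mass 1. Finally, r enters Q_r as a mere parameter, with no regularity: the identity is
    proved for each r, and the constants cross the integral in r by a scaling lemma for arbitrary
    nonnegative functions. *)

(** * Integration with densities, image measures and independence *)

Section scaling.
Context d (T : measurableType d) (R : realType).
Variables (mu : {measure set T -> \bar R}) (D : set T).
Local Open Scope ereal_scope.
Import HBNNSimple.

Let le_scale (k : R) (f : T -> \bar R) : (0 < k)%R ->
  (forall x, D x -> 0 <= f x) ->
  k%:E * \int[mu]_(x in D) f x <= \int[mu]_(x in D) (k%:E * f x).
Proof.
move=> k0 f0; rewrite -lee_pdivlMl//.
have kf0 x : D x -> 0 <= k%:E * f x.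
  by move=> Dx; apply: mule_ge0; [rewrite lee_fin ltW|exact: f0].
rewrite integral_mkcond ge0_integralTE; last exact: erestrict_ge0.
apply: ge_ereal_sup => _ [h /= hf <-].
rewrite lee_pdivlMl// integral_mkcond ge0_integralTE; last first.
  exact: erestrict_ge0.
rewrite -sintegralrM; apply: ereal_sup_ubound => /=.
exists (mul_nnsfun (cst_nnsfun T (NngNum (ltW k0))) h) => //= x.
rewrite EFinM; apply: (@le_trans _ _ (k%:E * (f \_ D) x)).
  by rewrite lee_pmul2l.
by rewrite !patchE; case: ifPn => // _; rewrite mule0.
Qed.

(** Made for integrands with no known measurability, such as the probability of an event under [Q r]
    as a function of [r]. The integral of a nonnegative function is a supremum over simple functions
    below it, and a simple function below [f] becomes one below [k f] when multiplied by [k]; this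
    inequality is used for [k] and for its inverse. *)
Lemma ge0_integral_scale (k : R) (f : T -> \bar R) : (0 < k)%R ->
  (forall x, D x -> 0 <= f x) ->
  \int[mu]_(x in D) (k%:E * f x) = k%:E * \int[mu]_(x in D) f x.
Proof.
move=> k0 f0; apply/eqP; rewrite eq_le le_scale// andbT.
rewrite -lee_pdivrMl// (le_trans (le_scale _ _)) ?invr_gt0//.
  by move=> x Dx; apply: mule_ge0; [rewrite lee_fin ltW|exact: f0].
by under eq_integral do rewrite muleA -EFinM mulVf ?gt_eqF// mul1e.
Qed.
End scaling.

(* The proofs are arguments so that the measure structure is found by inference. *)
Definition with_density d (T : measurableType d) (R : realType)
    (mu : {measure set T -> \bar R}) (g : T -> R)
    (g0 : forall x, 0 <= g x) (mg : measurable_fun setT g) (A : set T) : \bar R :=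
  (\int[mu]_(x in A) (g x)%:E)%E.

Section with_density.
Context d (T : measurableType d) (R : realType) (mu : {measure set T -> \bar R}).
Variables (g : T -> R).
Hypotheses (g0 : forall x, 0 <= g x) (mg : measurable_fun setT g).
Local Open Scope ereal_scope.

Local Notation nu := (with_density mu g0 mg).

Let nu0 : nu set0 = 0.
Proof. by rewrite /with_density integral_set0. Qed.

Let nu_ge0 A : 0 <= nu A.
Proof. by apply: integral_ge0 => x _; rewrite lee_fin. Qed.

Let nu_sigma_additive : semi_sigma_additive nu.
Proof.
move=> /= F mF tF mUF; rewrite /with_density; apply: cvg_toP.
  apply: ereal_nondecreasing_is_cvgn => m n mn.
  by apply: lee_sum_nneg_natr => // k _ _; exact: nu_ge0.
rewrite ge0_integral_bigcup//=; first by apply/measurable_EFinP; exact: measurable_funTS.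
by move=> x _; rewrite lee_fin.
Qed.

HB.instance Definition _ := isMeasure.Build _ _ _
  nu nu0 nu_ge0 nu_sigma_additive.

Import HBNNSimple.

Let ge0_integral_with_density_indic (A : set T) : measurable A ->
  \int[nu]_x (\1_A x)%:E = \int[mu]_x ((\1_A x)%:E * (g x)%:E).
Proof.
move=> mA; rewrite integral_indic// setIT -[LHS]/(\int[mu]_(x in A) (g x)%:E) [LHS]integral_mkcond.
apply: eq_integral => x _; rewrite patchE indicE.
by case: ifPn => _; rewrite ?mul1e ?mul0e.
Qed.

Let ge0_integral_with_density_nnsfun (h : {nnsfun T >-> R}) :
  \int[nu]_x (h x)%:E = \int[mu]_x ((h x)%:E * (g x)%:E).
Proof.
under [LHS]eq_integral do rewrite fimfunE -fsumEFin//.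
rewrite ge0_integral_fsum//; last 2 first.
  - by move=> r; exact/measurable_EFinP/measurableT_comp.
  - by move=> r x _; rewrite EFinM nnfun_muleindic_ge0.
under [RHS]eq_integral.
  move=> x _; rewrite fimfunE -fsumEFin// ge0_mule_fsuml; last first.
    by move=> r; rewrite EFinM nnfun_muleindic_ge0.
  over.
rewrite ge0_integral_fsum//; last 2 first.
  - move=> r; apply: emeasurable_funM; apply/measurable_EFinP => //.
    exact: measurableT_comp.
  - move=> r x _; apply: mule_ge0; last by rewrite lee_fin.
    by rewrite EFinM nnfun_muleindic_ge0.
apply: eq_fsbigr => r /set_mem[t _ <-].
under [LHS]eq_integral do rewrite EFinM.
rewrite ge0_integralZl//=; [|exact/measurable_EFinP|by rewrite lee_fin].
rewrite ge0_integral_with_density_indic//.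
rewrite -ge0_integralZl//=; last 3 first.
- by apply: emeasurable_funM; apply/measurable_EFinP.
- by move=> x _; rewrite -EFinM lee_fin mulr_ge0.
- by rewrite lee_fin.
by apply: eq_integral => x _; rewrite EFinM muleA.
Qed.

Lemma ge0_integral_with_density (f : T -> \bar R) :
  (forall x, 0 <= f x) -> measurable_fun setT f ->
  \int[nu]_x f x = \int[mu]_x (f x * (g x)%:E).
Proof.
move=> f0 mf; pose h := nnsfun_approx measurableT mf.
have hf x : EFin \o h^~ x @ \oo --> f x by exact: cvg_nnsfun_approx.
have mh n : measurable_fun setT (EFin \o h n) by exact/measurable_EFinP.
have hnd x : {homo (fun n => (h n x)%:E) : m n / (m <= n)%N >-> m <= n}.
  by move=> m n mn; rewrite lee_fin; exact/lefP/nd_nnsfun_approx.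
transitivity (limn (fun n => \int[nu]_x (h n x)%:E)).
  rewrite -monotone_convergence//.
  - by apply: eq_integral => x _; apply/esym/cvg_lim => //; exact: hf.
  - by move=> n x _; rewrite lee_fin.
under eq_fun do rewrite ge0_integral_with_density_nnsfun.
rewrite -monotone_convergence//.
- apply: eq_integral => x _; apply/cvg_lim => //.
  by apply: cvgeZr => //; exact: hf.
- by move=> n; apply: emeasurable_funM => //; exact/measurable_EFinP.
- by move=> n x _; rewrite -EFinM lee_fin mulr_ge0.
- by move=> x _ m n mn; apply: lee_wpmul2r; rewrite ?lee_fin//; exact: hnd.
Qed.
End with_density.

Definition image_measure d d1 (T : measurableType d) (V : measurableType d1)
    (R : realType) (mu : {measure set T -> \bar R}) (X : T -> V)
    (mX : measurable_fun setT X) : {measure set V -> \bar R} :=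
  @measure_function_pushforward__canonical__measure_function_Measure
    _ _ _ _ _ mu X mX.

Lemma ge0_integral_image_measure d d1 (T : measurableType d) (V : measurableType d1)
    (R : realType) (mu : {measure set T -> \bar R}) (X : T -> V)
    (mX : measurable_fun setT X) (f : V -> \bar R) :
  (forall x, (0 <= f x)%E) -> measurable_fun setT f ->
  (\int[image_measure mu mX]_x f x = \int[mu]_w f (X w))%E.
Proof. by move=> f0 mf; rewrite ge0_integral_pushforward// preimage_setT. Qed.

(** An alias of [mu] that carries the proof of finite mass, so that instance inference finds the
    finite measure needed to form a product with [e]. *)
Definition finite_of d (T : measurableType d) (R : realType)
  (mu : {measure set T -> \bar R}) (h : (mu setT < +oo)%E) : set T -> \bar R := mu.

Section finite_of.
Context d (T : measurableType d) (R : realType) (mu : {measure set T -> \bar R}).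
Hypothesis h : (mu setT < +oo)%E.
HB.instance Definition _ := isMeasure.Build _ _ _ (finite_of h)
  (measure0 mu) (measure_ge0 mu) (@measure_semi_sigma_additive _ _ _ mu).
HB.instance Definition _ :=
  Measure_isFinite.Build _ _ _ (finite_of h) (lty_fin_num_fun h).
End finite_of.

(* The identity on rectangles says that, under the measures with densities Y and Z,
   H is independent of X with law e; it extends to all functions of (X, H). *)
Lemma ge0_integral_independent d d1 (T : measurableType d) (V : measurableType d1)
    d2 (W : measurableType d2)
    (R : realType) (P : {measure set T -> \bar R}) (e : probability W R)
    (X : T -> V) (H : T -> W) (Y Z : T -> R) (f : V * W -> \bar R) :
  measurable_fun setT X -> measurable_fun setT H ->
  measurable_fun setT Y -> measurable_fun setT Z ->
  (forall w, 0 <= Y w) -> (forall w, 0 <= Z w) ->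
  (\int[P]_w (Z w)%:E < +oo)%E ->
  (forall B D, measurable B -> measurable D ->
     \int[P]_(w in X @^-1` B `&` H @^-1` D) (Y w)%:E =
     (\int[P]_(w in X @^-1` B) (Z w)%:E) * e D)%E ->
  (forall x, (0 <= f x)%E) -> measurable_fun setT f ->
  (\int[P]_w (f (X w, H w) * (Y w)%:E) =
   \int[P]_w ((\int[e]_h f (X w, h)) * (Z w)%:E))%E.
Proof.
move=> mX mH mY mZ Y0 Z0 Zfin rect f0 mf.
have mXH : measurable_fun setT (fun w => (X w, H w)) by exact: measurable_fun_pair.
pose m0 := image_measure (with_density P Z0 mZ) mX.
have fin0 : (m0 setT < +oo)%E by exact: Zfin.
pose m : {finite_measure set V -> \bar R} := finite_of fin0.
(* [m1] is the joint law of [(X, H)] under the density [Y], and [m] the law of [X] under the density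
   [Z]. By [rect], [m1] agrees on rectangles with the product of [m] and [e], hence everywhere by
   uniqueness of the product measure. *)
pose m1 := image_measure (with_density P Y0 mY) mXH.
have m1E : forall A, measurable A -> (m \x e)%E A = m1 A.
  apply: product_measure_unique => A B mA mB.
  by rewrite -[RHS](rect A B mA mB).
have mF : measurable_fun setT (fubini_F e f) by exact: measurable_fun_fubini_tonelli_F.
transitivity (\int[m1]_x f x)%E.
  rewrite [RHS]ge0_integral_image_measure// [RHS]ge0_integral_with_density//.
  exact: measurableT_comp.
rewrite (eq_measure_integral (m \x e)%E); last by move=> A mA _; exact/esym/m1E.
rewrite fubini_tonelli1//.
transitivity (\int[m0]_x fubini_F e f x)%E; first by [].
have F0 x : (0 <= fubini_F e f x)%E by exact: integral_ge0.
rewrite [LHS]ge0_integral_image_measure// [LHS]ge0_integral_with_density//.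
exact: measurableT_comp.
Qed.

(** * The exponential law and exponentials of extended reals *)

Definition exp1 (R : realType) : probability (measurableTypeR R) R :=
  @exponential_distribution_exponential_prob__canonical__probability_measure_Probability R 1 ltr01.

(** Multiplied by the density of rate 1, the integrand is [(1 + c)^-1] times the exponential density
    of rate [1 + c], whose total mass is 1. *)
Lemma exp1_laplace (R : realType) (c : R) : 0 <= c ->
  (\int[exp1 R]_h (expR (- (c * h)))%:E = ((1 + c)^-1)%:E)%E.
Proof.
move=> c0; have c1 : 0 < 1 + c by rewrite ltr_pwDl.
have mpdf (r : R) : measurable_fun setT (exponential_pdf r).
  exact: measurable_exponential_pdf.
rewrite (eq_measure_integral (with_density (@lebesgue_measure R)
  (exponential_pdf_ge0 (@ler01 R)) (mpdf 1))); last by [].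
have mexp : measurable_fun setT (fun h : R => expR (- (c * h))).
  by apply: measurableT_comp => //; apply: measurableT_comp.
rewrite ge0_integral_with_density//; last exact/measurable_EFinP.
transitivity (\int[@lebesgue_measure R]_x
    (((1 + c)^-1)%:E * (exponential_pdf (1 + c) x)%:E))%E.
  apply: eq_integral => x _; rewrite -!EFinM; congr EFin.
  have [x0|x0] := ltP x 0; first by rewrite !lt0_exponential_pdf// !mulr0.
  rewrite !exponential_pdfE// mul1r [RHS]mulrA mulVf ?gt_eqF// mul1r -expRD.
  by congr expR; rewrite !mulNr mul1r mulrDl mul1r opprD addrC.
rewrite ge0_integralZl//=.
- by rewrite integral_exponential_pdf// mule1.
- by apply/measurable_EFinP; exact: mpdf.
- by move=> x _; rewrite lee_fin exponential_pdf_ge0// ltW.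
- by rewrite lee_fin invr_ge0 ltW.
Qed.

Lemma exp1_tail (R : realType) (y : R) : 0 <= y ->
  exp1 R [set h | y < h] = (expR (- y))%:E.
Proof.
move=> y0; have -> : [set h | y < h] = ~` `]-oo, y]%classic.
  by apply/seteqP; split => x /=; rewrite in_itv/= ltNge => /negP.
rewrite probability_setC// (_ : exp1 R _ = (1 - expR (- y))%:E).
  by rewrite -EFinB opprB addrC subrK.
have -> : exp1 R `]-oo, y]%classic = exp1 R `[0, y]%classic.
  rewrite /exp1/= /exponential_prob integral_mkcond [RHS]integral_mkcond.
  apply: eq_integral => x _; rewrite !patchE !mem_setE !in_itv/=.
  have [x0|x0] := ltP x 0 => /=; last by [].
  by case: ifP => // _; rewrite lt0_exponential_pdf.
(* At [y = 0] the interval is a single point, of mass 0. *)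
move: y0; rewrite le_eqVlt => /predU1P[<-|y0].
  rewrite oppr0 expR0 subrr set_itv1.
  by rewrite /exp1/= /exponential_prob integral_set1.
by rewrite [LHS]exponential_prob_itv0c// mulN1r.
Qed.

(** Covers [l = +oo]. The infimum is itself of the form [expeR y], because [expeR] reaches every
    nonnegative extended real; comparing [y] with [- l] is then a matter of order, without
    continuity at infinity. *)
Lemma ereal_inf_expeRN (R : realType) (s : nat -> \bar R) (l : \bar R) :
  {homo s : m n / (m <= n)%N >-> (m <= n)%E} -> s @ \oo --> l ->
  ereal_inf (range (fun n => expeR (- s n))) = expeR (- l).
Proof.
move=> snd sl; have sle n : (s n <= l)%E.
  rewrite -(cvg_lim _ sl)//; apply: lime_ge; first by apply/cvg_ex; exists l.
  by near=> m; apply: snd; near: m; exact: nbhs_infty_ge.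
apply/eqP; rewrite eq_le; apply/andP; split; last first.
  by apply: le_ereal_inf_tmp => _ [n _ <-]; rewrite lee_expeR leeN2.
have [y yE] : exists y, expeR y = ereal_inf (range (fun n => expeR (- s n))).
  by apply: expeR_total; apply: le_ereal_inf_tmp => _ [n _ <-]; exact: expeR_ge0.
rewrite -yE lee_expeR leeNr -(cvg_lim _ sl)//; apply: lime_le.
  by apply/cvg_ex; exists l.
apply: nearW => n; rewrite leeNr -lee_expeR yE.
by apply: ereal_inf_lbound; exists n.
Unshelve. all: by end_near. Qed.

(** The factor may be [+oo]: it will be a product of extended-real generating functions. *)
Lemma ge0_nneseriesZl (R : realType) (f : nat -> \bar R) (x : \bar R) :
  (0 <= x)%E -> (forall n, 0 <= f n)%E ->
  (\sum_(n <oo) (x * f n) = x * \sum_(n <oo) f n)%E.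
Proof.
move=> x0 f0; case: x x0 => [x _|_|//]; first exact: nneseriesZl.
have [[k fk0]|fz] := pselect (exists k, f k != 0%E); last first.
  have f_eq0 n : f n = 0%E.
    by apply/eqP; apply/negPn/negP => fn; apply: fz; exists n.
  by rewrite !eseries0// ?mule0// => n _ _; rewrite f_eq0// mule0.
have fk : (0 < f k)%E by rewrite lt0e fk0 f0.
have -> : (\sum_(n <oo) (+oo * f n) = +oo)%E.
  apply: (@nneseries_pinfty _ _ _ k) => //; last by rewrite gt0_mulye.
  by move=> n _; rewrite mule_ge0.
rewrite gt0_mulye//; apply: (lt_le_trans fk).
rewrite (@nneseriesD1 _ _ k)//.
by rewrite leeDl//; exact: nneseries_ge0.
Qed.

Lemma emeasurable_prod d (T : measurableType d) (R : realType) (I : Type)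
    (s : seq I) (p : pred I) (h : I -> T -> \bar R) :
  (forall i, measurable_fun setT (h i)) ->
  measurable_fun setT (fun w => \prod_(i <- s | p i) h i w)%E.
Proof.
move=> mh; elim: s => [|i s ih].
  by under eq_fun do rewrite big_nil; exact: measurable_cst.
under eq_fun do rewrite big_cons.
by case: (p i) => //; exact: emeasurable_funM.
Qed.

(** * The generating functional of a Poisson process *)

Section poisson.
Context (R : realType) d (T : measurableType d) (P : probability T R).
Variables (lambda : R) (X : nat -> T -> R * R).
Hypothesis lambda0 : 0 < lambda.
Hypothesis mX : forall n, measurable_fun setT (X n).
Hypothesis HX : is_ppp P lambda X.

Let pois (a : R) (m : nat) := a ^+ m / m`!%:R * expR (- a).

Let pois_ge0 a m : 0 <= a -> 0 <= pois a m.
Proof. by move=> a0; rewrite mulr_ge0 ?expR_ge0// divr_ge0 ?exprn_ge0. Qed.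

Lemma measurable_count_points A : measurable A ->
  measurable_fun setT (count_points X A).
Proof.
move=> mA; apply: ge0_emeasurable_sum => [n w _ _|n _].
  by rewrite lee_fin.
apply/measurable_EFinP; apply: measurableT_comp => //.
Qed.

Let measurable_level A (m : nat) : measurable A ->
  measurable [set w | count_points X A w = m%:R%:E].
Proof.
move=> mA; rewrite -[X in measurable X]setTI.
exact: (measurable_count_points mA measurableT (emeasurable_set1 _)).
Qed.

(* The value on infinite counts is 0, which is also the value of the
   corresponding infinite product as soon as g decays. *)
Let gen (A : set (R * R)) (g : nat -> R) (w : T) : \bar R :=
  (\sum_(m <oo) (g m)%:E * (\1_[set w | count_points X A w = m%:R%:E] w)%:E)%E.

Let measurable_gen A g : (forall m, 0 <= g m) -> measurable A ->
  measurable_fun setT (gen A g).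
Proof.
move=> g0 mA; apply: ge0_emeasurable_sum => [m w _ _|m _].
  by rewrite -EFinM lee_fin mulr_ge0.
apply: measurable_funeM; apply/measurable_EFinP.
exact/measurable_indic/measurable_level.
Qed.

Let gen_ge0 A g w : (forall m, 0 <= g m) -> (0 <= gen A g w)%E.
Proof.
by move=> g0; apply: nneseries_ge0 => m _ _; rewrite -EFinM lee_fin mulr_ge0.
Qed.

(** Independence passes from levels to functions of the counts by induction on [j]: in [F j] the
    first [j] factors are generating functions, the others indicators of the levels [m]. The case
    [j = 0] is the definition of a Poisson process. The step expands one generating function as a
    series over levels and applies the induction hypothesis to each, which is why [key] quantifies
    over [m]. *)
Let ppp_product (k : nat) (A : 'I_k -> set (R * R)) (g : 'I_k -> nat -> R) :
  (forall i m, 0 <= g i m) -> (forall i, measurable (A i)) ->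
  (forall i, (area (A i) < +oo)%E) ->
  (forall i j, i != j -> A i `&` A j = set0) ->
  (\int[P]_w \prod_(i < k) gen (A i) (g i) w =
   \prod_(i < k)
     \sum_(m <oo) (g i m * pois (lambda * fine (area (A i))) m)%:E)%E.
Proof.
move=> g0 mA finA disjA.
pose a i := lambda * fine (area (A i)).
have a0 i : 0 <= a i.
  by rewrite mulr_ge0 ?(ltW lambda0)// fine_ge0// measure_ge0.
pose S i := (\sum_(m <oo) (g i m * pois (a i) m)%:E)%E.
have S0 i : (0 <= S i)%E.
  by apply: nneseries_ge0 => m _ _; rewrite lee_fin mulr_ge0 ?pois_ge0.
pose ind i (m : nat) w : \bar R := (\1_[set w | count_points X (A i) w = m%:R%:E] w)%:E.
have mind i m : measurable_fun setT (ind i m).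
  exact/measurable_EFinP/measurable_indic/measurable_level.
pose F (j : nat) (m : 'I_k -> nat) (i : 'I_k) w :=
  if (i < j)%N then gen (A i) (g i) w else ind i (m i) w.
have F0 j m i w : (0 <= F j m i w)%E.
  by rewrite /F; case: ifP => // _; [exact: gen_ge0|rewrite lee_fin].
have mF j m i : measurable_fun setT (F j m i).
  by rewrite /F; case: (i < j)%N; [exact: measurable_gen|exact: mind].
pose G (j : nat) (m : 'I_k -> nat) (i : 'I_k) : \bar R :=
  if (i < j)%N then S i else (pois (a i) (m i))%:E.
have key j : (j <= k)%N -> forall m : 'I_k -> nat,
    (\int[P]_w \prod_(i < k) F j m i w = \prod_(i < k) G j m i)%E.
  elim: j => [_ m|j ih jk m].
    rewrite /F /G /=.
    transitivity (P [set w | forall i, count_points X (A i) w = (m i)%:R%:E]).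
      rewrite -[in RHS](setIT [set w | _]) -integral_indic//; last first.
        rewrite (_ : [set w | _] = \bigcap_(i in [set: 'I_k])
            [set w | count_points X (A i) w = (m i)%:R%:E]); last first.
          by apply/seteqP; split => w /=; [move=> h i _|move=> h i]; exact: h.
        by apply: fin_bigcap_measurable => // i _; exact: measurable_level.
      apply: eq_integral => w _; rewrite /ind prodEFin; congr EFin.
      rewrite [RHS]indicE.
      have [h|h] := pselect (forall i, count_points X (A i) w = (m i)%:R%:E).
        rewrite mem_set// big1// => i _.
        by rewrite indicE mem_set//=; exact: h.
      rewrite memNset//; move/existsNP: h => [i /eqP h]; rewrite (bigD1 i)//=.
      by rewrite indicE memNset ?mul0r//=; exact/eqP.
    rewrite HX//; rewrite prodEFin.
    by [].
  pose jj := Ordinal jk.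
  pose upd n i := if i == jj then n else m i.
  pose rest w := (\prod_(i < k | i != jj) F j m i w)%E.
  have neqF n w : (\prod_(i < k | i != jj) F j (upd n) i w = rest w)%E.
    apply: eq_bigr => i ij; rewrite /F /upd; case: ifP => // _.
    by rewrite (negbTE ij).
  have rest0 w : (0 <= rest w)%E by apply: prode_ge0.
  have mrest : measurable_fun setT rest by exact: emeasurable_prod.
  transitivity (\int[P]_w \sum_(n <oo) ((g jj n)%:E * (ind jj n w * rest w)))%E.
    apply: eq_integral => w _; rewrite (bigD1 jj)//= {1}/F ltnSn.
    rewrite (_ : (\prod_(i < k | i != jj) _)%E = rest w); last first.
      apply: eq_bigr => i ij; rewrite /F ltnS leq_eqVlt.
      by rewrite (_ : (i == j :> nat) = false)//; exact: negbTE.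
    rewrite /gen muleC -ge0_nneseriesZl//.
      by apply: eq_eseriesr => n _; rewrite muleCA [X in (_ * X)%E]muleC.
    by move=> n; rewrite -EFinM lee_fin mulr_ge0.
  rewrite integral_nneseries//; last 2 first.
  - by move=> n; apply: measurable_funeM; exact: emeasurable_funM.
  - by move=> n w _; rewrite mule_ge0 ?lee_fin// mule_ge0// lee_fin.
  pose C := (\prod_(i < k | i != jj) G j m i)%E.
  have C0 : (0 <= C)%E.
    by apply: prode_ge0 => i _; rewrite /G; case: ifP => // _; rewrite lee_fin pois_ge0.
  transitivity (\sum_(n <oo) (C * ((g jj n * pois (a jj) n)%:E)))%E.
    apply: eq_eseriesr => n _; rewrite ge0_integralZl//; last 3 first.
    - exact: emeasurable_funM.
    - by move=> w _; rewrite mule_ge0// lee_fin.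
    - by rewrite lee_fin.
    transitivity ((g jj n)%:E * \int[P]_w \prod_(i < k) F j (upd n) i w)%E.
      congr (_ * _)%E; apply: eq_integral => w _.
      by rewrite [RHS](bigD1 jj)//= neqF {1}/F ltnn /upd eqxx.
    rewrite ih ?(ltnW jk)// (bigD1 jj)//= {1}/G ltnn /upd eqxx.
    rewrite (_ : (\prod_(i < k | i != jj) _)%E = C); last first.
      apply: eq_bigr => i ij; rewrite /G; case: ifP => // _.
      by rewrite (negbTE ij).
    by rewrite muleA -EFinM muleC.
  rewrite ge0_nneseriesZl//; last first.
    by move=> n; rewrite lee_fin mulr_ge0 ?pois_ge0.
  rewrite [RHS](bigD1 jj)//= {1}/G ltnSn muleC; congr (_ * _)%E.
  apply: eq_bigr => i ij; rewrite /G [in RHS]ltnS [in RHS]leq_eqVlt.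
  by rewrite (_ : (i == j :> nat) = false)//; exact: negbTE.
have := key k (leqnn k) (fun=> 0%N).
rewrite /F /G; under eq_integral do under eq_bigr do rewrite ltn_ord.
by under [in RHS]eq_bigr do rewrite ltn_ord.
Qed.

(** The expectation of [z ^ N] for a Poisson variable [N] of mean [a], summed by the exponential
    series. *)
Let pgf z a : 0 <= z -> 0 <= a ->
  (\sum_(m <oo) (z ^+ m * pois a m)%:E = (expR (- (a * (1 - z))))%:E)%E.
Proof.
move=> z0 a0.
transitivity (\sum_(m <oo) ((expR (- a))%:E * ((z * a) ^+ m / m`!%:R)%:E))%E.
  apply: eq_eseriesr => m _; rewrite -EFinM; congr EFin.
  by rewrite /pois exprMn [LHS]mulrA [LHS]mulrC [z ^+ m * _]mulrA.
rewrite nneseriesZl; last first.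
  by move=> m _; rewrite lee_fin divr_ge0 ?exprn_ge0 ?mulr_ge0.
rewrite mulrBr mulr1 opprB addrC expRD EFinM [a * z]mulrC; congr (_ * _)%E.
rewrite [in RHS]/expR -EFin_lim; last exact: is_cvg_series_exp_coeff.
by apply/congr_lim/funext => n/=; rewrite /series/= -sumEFin.
Qed.

Local Notation leb := (@lebesgue_measure R).
Local Notation leb2 := (leb \x leb)%E.

Let genE A g w m : count_points X A w = m%:R%:E -> (forall m, 0 <= g m) ->
  gen A g w = (g m)%:E.
Proof.
move=> mE g0; rewrite /gen (@nneseriesD1 _ _ m)//=; last first.
  by move=> n _; rewrite -EFinM lee_fin mulr_ge0.
rewrite indicE mem_set//= mule1 eseries0 ?adde0// => n _ nm.
rewrite indicE memNset ?mule0//= mE => -[] /eqP; rewrite eqr_nat.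
by rewrite eq_sym (negbTE nm).
Qed.

(** The definition prescribes the probability of each finite count; these masses sum to 1, so an
    infinite count has probability 0. With [g = 1], [gen] is the indicator of a finite count. *)
Let count_finite A : measurable A -> (area A < +oo)%E ->
  {ae P, forall w, exists m : nat, count_points X A w = m%:R%:E}.
Proof.
move=> mA finA.
pose a := lambda * fine (area A).
have a0 : 0 <= a by rewrite mulr_ge0 ?(ltW lambda0)// fine_ge0// measure_ge0.
have mL : measurable [set w | exists m : nat, count_points X A w = m%:R%:E].
  rewrite (_ : [set w | _] =
      \bigcup_m [set w | count_points X A w = m%:R%:E]); last first.
    by apply/seteqP; split => w /= [m]; [exists m|move=> _ ?; exists m].
  by apply: bigcup_measurable => m _; exact: measurable_level.
suff PL : P [set w | exists m : nat, count_points X A w = m%:R%:E] = 1%E.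
  exists (~` [set w | exists m : nat, count_points X A w = m%:R%:E]); split => //.
  - exact: measurableC.
  - by rewrite probability_setC// PL subee.
have := @ppp_product 1 (fun=> A) (fun _ _ => 1) (fun _ _ => ler01)
  (fun=> mA) (fun=> finA).
have H i j : i != j :> 'I_1 -> A `&` A = set0 by rewrite !ord1 eqxx.
move=> /(_ H).
under eq_integral do rewrite big_ord1.
rewrite big_ord1 (_ : (\sum_(m <oo) _)%E = (\sum_(m <oo) (1 ^+ m * pois a m)%:E)%E); last first.
  by apply: eq_eseriesr => m _; rewrite expr1n.
rewrite pgf// subrr mulr0 oppr0 expR0 => <-.
rewrite -[X in P X]setIT -integral_indic//.
apply: eq_integral => w _; rewrite indicE.
have [[m mE]|h] := pselect (exists m : nat, count_points X A w = m%:R%:E).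
  by rewrite mem_set ?(genE mE)//; exists m.
rewrite memNset// /gen eseries0// => n _ _.
by rewrite indicE memNset ?mule0//= => nE; apply: h; exists n.
Qed.

(** Integers that converge to an integer are eventually equal to it. This turns convergence of the
    partial counts into equality of exponents. *)
Let count_eventually A w (m : nat) : count_points X A w = m%:R%:E ->
  \forall n \near \oo, (\sum_(l < n) (X l w \in A))%N = m.
Proof.
move=> mE.
have h : (\sum_(l < n) (X l w \in A))%N%:R%:E @[n --> \oo] --> (m%:R%:E : \bar R).
  rewrite (_ : (fun n => _) = (fun n => \sum_(0 <= l < n) (\1_A (X l w))%:E)%E).
    by rewrite -mE; apply: is_cvg_nneseries => l _ _; rewrite lee_fin.
  apply/funext => n; rewrite sumEFin natr_sum big_mkord; congr EFin.
have cvgA : (\sum_(l < n) (X l w \in A))%N%:R @[n --> \oo] --> (m%:R : R).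
  exact: (fine_cvg h).
move/cvgrPdist_lt : cvgA => /(_ 1 ltr01); apply: filterS => n.
rewrite distrC; set s := (\sum_(_ < _) _)%N => sm.
have [lt|lt|//] := ltngtP s m.
  move: sm; rewrite distrC -natrB ?(ltnW lt)// normr_nat ltrn1 ltnS leqn0 subn_eq0.
  by rewrite leqNgt lt.
move: sm; rewrite -natrB ?(ltnW lt)// normr_nat ltrn1 ltnS leqn0 subn_eq0.
by rewrite leqNgt lt.
Qed.

Let measurable_partial_product (F : R * R -> R) n : measurable_fun setT F ->
  measurable_fun setT (fun w => (\prod_(l < n) F (X l w))%:E).
Proof.
move=> mF; apply/measurable_EFinP; apply: measurable_prod => l _.
exact: measurableT_comp.
Qed.

(** As the [A i] are disjoint, [1 - u] is the product of the powers [(1 - c i) ^+ (x \in A i)], so a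
    product over stations is a product over [i] of [1 - c i] raised to the count in [A i]. Almost
    surely the counts are finite, so these exponents are eventually constant, and every product lies
    in [0, 1]. *)
Let ppp_simple (k : nat) (A : 'I_k -> set (R * R)) (c : 'I_k -> R) :
  (forall i, 0 <= c i <= 1) -> (forall i, measurable (A i)) ->
  (forall i, (area (A i) < +oo)%E) ->
  (forall i j, i != j -> A i `&` A j = set0) ->
  (\int[P]_w (\prod_(l < n) (1 - \sum_(i < k) c i * \1_(A i) (X l w)))%:E)%E
    @[n --> \oo] -->
  expeR (- (lambda%:E * \int[leb2]_x (\sum_(i < k) c i * \1_(A i) x)%:E)).
Proof.
move=> c01 mA finA disjA.
have z0 i : 0 <= 1 - c i by rewrite subr_ge0; have /andP[] := c01 i.
have z1 i : 1 - c i <= 1 by rewrite gerBl; have /andP[] := c01 i.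
have uE x : 1 - \sum_(i < k) c i * \1_(A i) x = \prod_(i < k) (1 - c i) ^+ (x \in A i).
  have [[i xAi]|h] := pselect (exists i, A i x); last first.
    rewrite !big1 ?subr0// => i _.
      by rewrite memNset// => xAi; apply: h; exists i.
    by rewrite indicE memNset ?mulr0// => xAi; apply: h; exists i.
  have nj j : j != i -> (x \in A j) = false.
    move=> ij; apply: memNset => xAj.
    by have : (A j `&` A i) x by []; rewrite disjA.
  rewrite (bigD1 i)//= [in RHS](bigD1 i)//= !big1 ?addr0 ?mulr1 => [|j ij|j ij].
  - by rewrite indicE mem_set// mulr1 expr1.
  - by rewrite nj.
  - by rewrite indicE nj// mulr0.
have partE n w : \prod_(l < n) (1 - \sum_(i < k) c i * \1_(A i) (X l w)) =
    \prod_(i < k) (1 - c i) ^+ (\sum_(l < n) (X l w \in A i))%N.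
  under eq_bigr do rewrite uE.
  by rewrite exchange_big/=; apply: eq_bigr => i _; rewrite -expr_sum.
have part01 n w : 0 <= \prod_(l < n) (1 - \sum_(i < k) c i * \1_(A i) (X l w)) <= 1.
  rewrite partE; apply/andP; split.
    by apply: prodr_ge0 => i _; rewrite exprn_ge0.
  by apply: prodr_ile1 => i _; rewrite exprn_ge0//= exprn_ile1.
pose g i m := (1 - c i) ^+ m.
have g0 i m : 0 <= g i m by rewrite exprn_ge0.
have mu_ : measurable_fun setT (fun x => 1 - \sum_(i < k) c i * \1_(A i) x).
  apply: measurable_funB => //; apply: measurable_sum => i.
  by apply: measurable_funM => //.
have -> : expeR (- (lambda%:E * \int[leb2]_x (\sum_(i < k) c i * \1_(A i) x)%:E)) =
    (\int[P]_w \prod_(i < k) gen (A i) (g i) w)%E.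
  have a0 i : 0 <= fine (area (A i)) by rewrite fine_ge0// measure_ge0.
  rewrite ppp_product//.
  under [RHS]eq_bigr => i _.
    rewrite (pgf (z0 i)); last by rewrite mulr_ge0 ?(ltW lambda0).
    over.
  rewrite prodEFin /= -expR_sum.
  rewrite (_ : \int[leb2]_x _ = (\sum_(i < k) c i * fine (area (A i)))%:E)%E /=.
    congr (expR _)%:E; rewrite mulr_sumr -sumrN; apply: eq_bigr => i _.
    by ring.
  have mI i : measurable_fun (setT : set (measurableTypeR R * measurableTypeR R)%type)
      (\1_(A i) : _ -> R) by apply: measurable_indic; exact: mA.
  under eq_integral do rewrite -sumEFin.
  rewrite ge0_integral_sum//; last 2 first.
  - by move=> i; apply/measurable_EFinP; apply: measurable_funM => //; exact: mI.
  - by move=> i x _; rewrite lee_fin mulr_ge0//; have /andP[] := c01 i.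
  rewrite -sumEFin; apply: eq_bigr => i _.
  under eq_integral do rewrite EFinM.
  rewrite ge0_integralZl//; last 2 first.
  - by apply/measurable_EFinP; exact: mI.
  - by rewrite lee_fin; have /andP[] := c01 i.
  rewrite integral_indic//; last exact: mA.
  rewrite setIT EFinM fineK// ge0_fin_numE; first exact: finA.
  exact: measure_ge0.
have fin_ae : {ae P, forall w, forall i, exists m : nat,
    count_points X (A i) w = m%:R%:E}.
  apply: (@filter_forall _ _ (fun i w => exists m : nat,
    count_points X (A i) w = m%:R%:E)) => i.
  exact: count_finite.
have [] // := @dominated_convergence _ _ _ P setT measurableT
  (fun n w => (\prod_(l < n) (1 - \sum_(i < k) c i * \1_(A i) (X l w)))%:E)
  (fun w => \prod_(i < k) gen (A i) (g i) w)%E (cst 1%E).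
- by move=> n; exact: (@measurable_partial_product (fun x => 1 - \sum_(i < k) c i * \1_(A i) x)).
- apply: (@emeasurable_prod _ _ _ _ _ _ (fun i => gen (A i) (g i))) => i.
  exact: measurable_gen.
- apply: filterS fin_ae => w h _.
  have [m mE] := choice h.
  apply: cvg_near_cst.
  have -> : (\prod_(i < k) gen (A i) (g i) w)%E = (\prod_(i < k) (1 - c i) ^+ m i)%:E.
    by rewrite -prodEFin; apply: eq_bigr => i _; rewrite (genE (mE i)).
  have hn : \forall n \near \oo, forall i, (\sum_(l < n) (X l w \in A i))%N = m i.
    apply: (@filter_forall _ _
      (fun i n => (\sum_(l < n) (X l w \in A i))%N = m i)) => i.
    exact: count_eventually.
  apply: filterS hn => n hn.
  by rewrite partE; congr EFin; apply: eq_bigr => i _; rewrite hn.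
- by apply: finite_measure_integrable_cst.
- by apply: aeW => w n _; have /andP[? ?] := part01 n w; rewrite gee0_abs lee_fin.
Qed.

Import HBNNSimple.

(** The infinite product is encoded as a limit of expectations of finite products. Increasing the
    number [n] of factors or the index [k] of the approximation of [u] from below makes these
    expectations smaller, so both limits are infima. *)
Lemma ppp_pgfl (u : R * R -> R) : measurable_fun setT u ->
  (forall x, 0 <= u x <= 1) ->
  (\int[P]_w (\prod_(l < n) (1 - u (X l w)))%:E)%E @[n --> \oo] -->
  expeR (- (lambda%:E * \int[leb2]_x (u x)%:E)).
Proof.
move=> mfu u01.
have mEu : measurable_fun setT (EFin \o u) by exact/measurable_EFinP.
have u0 x : (0 <= (EFin \o u) x)%E by rewrite lee_fin; have /andP[] := u01 x.
pose h := nnsfun_approx measurableT mEu.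
have h_le k x : h k x <= u x.
  by rewrite -lee_fin /h nnsfun_approxE; exact: le_approx.
have h_cvg x : h k x @[k --> \oo] --> u x.
  apply: (@fine_cvg _ _ _ _ (EFin \o h ^~ x)).
  by apply: cvg_nnsfun_approx => // y _; exact: u0.
have h_nd x : {homo h ^~ x : m n / (m <= n)%N >-> m <= n}.
  by move=> m n mn; exact/lefP/nd_nnsfun_approx.
(* The level sets of [h k] may have infinite area, so [h k] is cut off outside a growing square. *)
pose I k : set R := `[- k%:R, k%:R]%classic.
pose B k : set (R * R) := I k `*` I k.
have mB k : measurable (B k) by apply: measurableX; exact: measurable_itv.
have finB k : (area (B k) < +oo)%E.
  have muI : (@lebesgue_measure R (I k) < +oo)%E.
    by rewrite /I lebesgue_measure_itv/=; case: ifP; rewrite ?ltry.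
  rewrite /area product_measure1E//; [|exact: measurable_itv|exact: measurable_itv].
  by apply: lte_mul_pinfty => //; rewrite ge0_fin_numE.
pose v k x := h k x * \1_(B k) x.
have h0 k x : 0 <= h k x by [].
have v01 k x : 0 <= v k x <= 1.
  rewrite /v mulr_ge0//= (le_trans _ (proj2 (andP (u01 x))))// (le_trans _ (h_le k x))//.
  by rewrite ler_piMr// indicE; case: (_ \in _).
have v_cvg x : v k x @[k --> \oo] --> u x.
  apply: cvg_trans (h_cvg x); apply: near_eq_cvg.
  near=> k; rewrite /v indicE mem_set ?mulr1//; split; rewrite /I/= in_itv/= -ler_norml.
    by near: k; exact: nbhs_infty_ger.
  by near: k; exact: nbhs_infty_ger.
have B_nd m n : (m <= n)%N -> B m `<=` B n.
  move=> mn [x y] [/=]; rewrite /I/= !in_itv/= -!ler_norml => xm ym.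
  by split; rewrite /I/= in_itv/= -ler_norml; [apply: le_trans xm _|apply: le_trans ym _];
    rewrite ler_nat.
have v_nd x : {homo v ^~ x : m n / (m <= n)%N >-> m <= n}.
  move=> m n mn; apply: ler_pM => //; first exact: h_nd.
  rewrite !indicE; have [xB|//] := boolP (x \in B m).
  by rewrite mem_set//; apply: (B_nd _ _ mn); move/set_mem: xB.
have mv k : measurable_fun setT (v k).
  by apply: measurable_funM => //; exact: measurable_indic.
have simple k : (\int[P]_w (\prod_(l < n) (1 - v k (X l w)))%:E)%E
    @[n --> \oo] --> expeR (- (lambda%:E * \int[leb2]_x (v k x)%:E)).
  pose s := fset_set (range (h k)).
  have vE : v k = fun x => \sum_(i < #|` s|) s`_i * \1_(h k @^-1` [set s`_i] `&` B k) x.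
    apply/funext => x; rewrite /v fimfunEord mulr_suml; apply: eq_bigr => i _.
    by rewrite -mulrA indicI.
  rewrite vE; apply: ppp_simple.
  - move=> i; have : s`_i \in s by rewrite mem_nth.
    rewrite in_fset_set// => /set_mem[y _ <-]; rewrite h0/=.
    by rewrite (le_trans (h_le k y))//; have /andP[] := u01 y.
  - by move=> i; apply: measurableI.
  - move=> i; apply: le_lt_trans (finB k); apply: le_measure.
    + by apply: mem_set; apply: (@measurableI _ (R * R)%type).
    + by apply: mem_set; exact: mB.
    + exact: subIsetr.
  - move=> i j ij; apply/seteqP; split => // x [[/= hi _] [/= hj _]].
    move: ij => /eqP; apply; apply/val_inj/eqP.
    rewrite -(nth_uniq 0 (ltn_ord i) (ltn_ord j) (fset_uniq s)); apply/eqP.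
    by rewrite -hi -hj.
pose E (F : R * R -> R) n := (\int[P]_w (\prod_(l < n) (1 - F (X l w)))%:E)%E.
have mE (F : R * R -> R) n : measurable_fun setT F ->
    measurable_fun setT (fun w => (\prod_(l < n) (1 - F (X l w)))%:E).
  move=> mF; apply: (@measurable_partial_product (fun x => 1 - F x)).
  exact: measurable_funB.
have prod0 (F : R * R -> R) n w : (forall x, 0 <= F x <= 1) -> 0 <= \prod_(l < n) (1 - F (X l w)).
  move=> F01; apply: prodr_ge0 => i _; rewrite subr_ge0.
  by have /andP[] := F01 (X i w).
have prod1 (F : R * R -> R) n w : (forall x, 0 <= F x <= 1) -> \prod_(l < n) (1 - F (X l w)) <= 1.
  move=> F01; apply: prodr_ile1 => i _; have /andP[? ?] := F01 (X i w).
  by rewrite subr_ge0 gerBl; apply/andP; split.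
have E_noninc (F : R * R -> R) : measurable_fun setT F -> (forall x, 0 <= F x <= 1) ->
    {homo E F : m n / (m <= n)%N >-> (n <= m)%E}.
  move=> mF F01; apply/nonincreasing_seqP => n; apply: ge0_le_integral => //.
  - by move=> w _; rewrite lee_fin prod0.
  - exact: mE.
  - exact: mE.
  - move=> w _; rewrite lee_fin big_ord_recr/= ler_piMr// ?prod0//.
    by rewrite gerBl; have /andP[] := F01 (X n w).
have E_inf (F : R * R -> R) l : measurable_fun setT F -> (forall x, 0 <= F x <= 1) ->
    E F @ \oo --> l -> l = ereal_inf (range (E F)).
  move=> mF F01 Fl; rewrite -(cvg_lim _ Fl)//; apply: cvg_lim => //.
  exact/ereal_nonincreasing_cvgn/E_noninc.
have E_k n : E (v k) n @[k --> \oo] --> E u n.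
  have [] // := @dominated_convergence _ _ _ P setT measurableT
    (fun k w => (\prod_(l < n) (1 - v k (X l w)))%:E)
    (fun w => (\prod_(l < n) (1 - u (X l w)))%:E) (cst 1%E).
  - by move=> k; exact: mE.
  - exact: mE.
  - apply: aeW => w _; apply: cvg_EFin; first exact: nearW.
    rewrite /comp /=; elim: n => [|n ih].
      rewrite big_ord0; under eq_fun do rewrite big_ord0; exact: cvg_cst.
    rewrite big_ord_recr; under eq_fun do rewrite big_ord_recr.
    apply: cvgM => //; apply: cvgB; [exact: cvg_cst|exact: v_cvg].
  - by apply: finite_measure_integrable_cst.
  - by apply: aeW => w m _; rewrite gee0_abs lee_fin ?prod0 ?prod1.
have E_k_noninc n : {homo (fun k => E (v k) n) : k l / (k <= l)%N >-> (l <= k)%E}.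
  move=> k l kl; apply: ge0_le_integral => //.
  - by move=> w _; rewrite lee_fin prod0.
  - exact: mE.
  - exact: mE.
  - move=> w _; rewrite lee_fin; apply: ler_prod => i _.
    by rewrite subr_ge0 lerB// ?v_nd// andbT; have /andP[] := v01 l (X i w).
have : E u @ \oo --> ereal_inf (range (E u)).
  exact/ereal_nonincreasing_cvgn/E_noninc.
suff -> : ereal_inf (range (E u)) = expeR (- (lambda%:E * \int[leb2]_x (u x)%:E)) by [].
pose S k := (lambda%:E * \int[leb2]_x (v k x)%:E)%E.
have mv2 k : measurable_fun (setT : set (measurableTypeR R * measurableTypeR R)%type)
   (fun x => (v k x)%:E) by apply/measurable_EFinP; exact: mv.
transitivity (ereal_inf (range (fun k => expeR (- S k)))); last first.
  apply: ereal_inf_expeRN.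
    move=> m n mn; apply: lee_wpmul2l; first by rewrite lee_fin ltW.
    apply: ge0_le_integral => //.
    - by move=> x _; rewrite lee_fin; have /andP[] := v01 m x.
    - by move=> x _; rewrite lee_fin v_nd.
  apply: cvgeZl => //.
  rewrite (_ : (\int[leb2]_x (u x)%:E) = (\int[leb2]_x (limn (fun k => (v k x)%:E))))%E.
    apply: cvg_monotone_convergence => //.
    - by move=> n x _; rewrite lee_fin; have /andP[] := v01 n x.
    - by move=> x _ m n mn; rewrite lee_fin v_nd.
  apply: eq_integral => x _; apply/esym/cvg_lim => //.
  by apply: cvg_EFin; [exact: nearW|exact: v_cvg].
(* The left side is [inf_n inf_k E (v k) n], the right side [inf_k inf_n E (v k) n]. *)
apply/eqP; rewrite eq_le; apply/andP; split; apply: le_ereal_inf_tmp => _ [n _ <-].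
  rewrite (E_inf _ _ (mv n) (v01 n) (simple n)).
  apply: le_ereal_inf_tmp => _ [m _ <-]; apply: (@le_trans _ _ (E u m)).
    by apply: ereal_inf_lbound; exists m.
  rewrite -(cvg_lim _ (E_k m))//; apply: lime_le; first by apply/cvg_ex; exists (E u m).
  by near=> k; apply: E_k_noninc; near: k; exact: nbhs_infty_ge.
rewrite -(cvg_lim _ (E_k n))//; apply: lime_ge; first by apply/cvg_ex; exists (E u n).
apply: nearW => k; apply: (@le_trans _ _ (expeR (- S k))).
  by apply: ereal_inf_lbound; exists k.
rewrite (E_inf _ _ (mv k) (v01 k) (simple k)).
by apply: ereal_inf_lbound; exists n.
Unshelve. all: by end_near. Qed.

End poisson.

(** * Measurability of elementary functions; Tonelli on the plane *)

(** The inverse is [x] times the inverse of its square, a real power of a nonnegative argument; at 0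
    both sides are 0. *)
Lemma measurable_inv (R : realType) : measurable_fun [set: R] (fun x : R => x^-1).
Proof.
rewrite (_ : (fun x => _) = (fun x : R => x * (x ^+ 2) `^ (-1))).
  apply: measurable_funM => //.
  by apply: measurableT_comp (measurable_powR _) _; exact: measurable_funX.
apply/funext => x; rewrite powR_inv1 ?sqr_ge0//.
have [->|x0] := eqVneq x 0; first by rewrite invr0 mul0r.
by rewrite expr2 invfM mulrA mulfV// mul1r.
Qed.

Lemma measurable_sqrt (R : realType) : measurable_fun [set: R] (@Num.sqrt R).
Proof. by apply: nondecreasing_measurable => // x y xy; exact: ler_wsqrtr. Qed.

Lemma measurable_cos (R : realType) : measurable_fun [set: R] (@cos R).
Proof. by apply: continuous_measurable_fun => x; exact: continuous_cos. Qed.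

Lemma measurable_sin (R : realType) : measurable_fun [set: R] (@sin R).
Proof. by apply: continuous_measurable_fun => x; exact: continuous_sin. Qed.

Section plane.
Context (R : realType).
Local Notation mR := (measurableTypeR R).
Local Notation leb := (@lebesgue_measure R).
Local Notation leb2 := (leb \x leb)%E.
Variable f : R * R -> \bar R.
Hypotheses (mf : measurable_fun setT f) (f0 : forall z, (0 <= f z)%E).

(** The same fact over [measurableTypeR R], the type that carries Lebesgue measure; the two
    structures are convertible. *)
Let mf2 : measurable_fun (setT : set (mR * mR)%type) f. Proof. exact: mf. Qed.

Lemma plane_tonelli1 : (\int[leb2]_z f z = \int[leb]_x \int[leb]_y f (x, y))%E.
Proof. exact: (@fubini_tonelli1 _ _ mR mR R leb leb f mf2 f0). Qed.

Lemma plane_tonelli2 : (\int[leb2]_z f z = \int[leb]_y \int[leb]_x f (x, y))%E.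
Proof. exact: (@fubini_tonelli2 _ _ mR mR R leb leb f mf2 f0). Qed.

Lemma plane_tonelli :
  (\int[leb]_x \int[leb]_y f (x, y) = \int[leb]_y \int[leb]_x f (x, y))%E.
Proof. by rewrite -plane_tonelli1 -plane_tonelli2. Qed.

Lemma measurable_plane_integral1 :
  measurable_fun (setT : set R) (fun x => \int[leb]_y f (x, y))%E.
Proof. exact: (@measurable_fun_fubini_tonelli_F _ _ mR mR R leb f mf2 f0). Qed.

Lemma measurable_plane_integral2 :
  measurable_fun (setT : set R) (fun y => \int[leb]_x f (x, y))%E.
Proof. exact: (@measurable_fun_fubini_tonelli_G _ _ mR mR R leb f mf2 f0). Qed.
End plane.

(** * One-dimensional changes of variables *)

Section change_of_variables.
Context (R : realType).
Local Notation mR := (measurableTypeR R).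
Local Notation leb := (@lebesgue_measure R).

(** The image under [phi] of the measure with density [w] is Lebesgue measure as soon as it gives
    the right mass to half-open intervals. In this form the substitution by [tan] is possible on the
    whole line, with [w] vanishing outside one branch. *)
Lemma lebesgue_change (phi w : R -> R) (g : R -> \bar R) :
  measurable_fun setT phi -> measurable_fun setT w ->
  (forall x, 0 <= w x) ->
  (forall a b : R, (a < b)%R ->
     \int[leb]_(x in phi @^-1` `]a, b]) (w x)%:E = (b - a)%R%:E)%E ->
  (forall x, (0 <= g x)%E) -> measurable_fun setT g ->
  (\int[leb]_x g x = \int[leb]_x (g (phi x) * (w x)%:E))%E.
Proof.
move=> mphi mw w0 H g0 mg.
have mphi' : measurable_fun (setT : set mR) (phi : mR -> mR) by exact: mphi.
have mw' : measurable_fun (setT : set mR) w by exact: mw.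
have mg' : measurable_fun (setT : set mR) g by exact: mg.
pose nu := image_measure (with_density leb w0 mw') mphi'.
have nuE A : measurable A -> leb A = nu A.
  apply: lebesgue_measure_unique => _ [[a b] _ <-] /=.
  rewrite lebesgue_measure_itv/= lte_fin.
  rewrite -[RHS]/(\int[leb]_(x in phi @^-1` `]a, b]) (w x)%:E)%E.
  case: ltP => ab; first by rewrite H// EFinB.
  by rewrite set_itv_ge -?leNgt ?bnd_simp// preimage_set0 integral_set0.
rewrite (eq_measure_integral nu); last by move=> A mA _; exact: nuE.
rewrite [LHS]ge0_integral_image_measure// [LHS]ge0_integral_with_density//.
exact: measurableT_comp.
Qed.

Lemma lebesgue_scale (c : R) (g : R -> \bar R) : 0 < c ->
  (forall x, (0 <= g x)%E) -> measurable_fun setT g ->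
  (\int[leb]_x g x = \int[leb]_x (g (c * x)%R * c%:E))%E.
Proof.
move=> c0 g0 mg; apply: (@lebesgue_change ( *%R c) (cst c)) => //.
- by move=> x; exact: ltW.
move=> a b ab; rewrite (_ : _ @^-1` _ = `]a / c, b / c]%classic).
  rewrite -[LHS]/(\int[leb]_(x in `](a / c)%R, (b / c)%R]%classic) (cst c%:E) x)%E.
  rewrite integral_cst//= lebesgue_measure_itv/= lte_fin ltr_pM2r ?invr_gt0// ab.
  by rewrite -EFinB -EFinM -mulrBl mulrC divfK ?gt_eqF.
apply/seteqP; split => x /=; rewrite !in_itv/= ltr_pdivrMr// ler_pdivlMr//;
  by rewrite ![x * c]mulrC.
Qed.

Lemma lebesgue_reflect (c : R) (g : R -> \bar R) :
  (forall x, (0 <= g x)%E) -> measurable_fun setT g ->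
  (\int[leb]_x g x = \int[leb]_x g (c - x)%R)%E.
Proof.
move=> g0 mg; rewrite (@lebesgue_change (fun x => c - x) (cst 1) g)//.
- by under eq_integral do rewrite mule1.
- by apply: measurable_funB.
move=> a b ab; rewrite (_ : _ @^-1` _ = `[c - b, c - a[%classic).
  rewrite -[LHS]/(\int[leb]_(x in `[(c - b)%R, (c - a)%R[%classic) (cst 1%E) x)%E.
  rewrite integral_cst//= lebesgue_measure_itv/= lte_fin ltrD2l ltrN2 ab mul1e.
  by rewrite -EFinB; congr EFin; ring.
by apply/seteqP; split => x /=; rewrite !in_itv/=; lra.
Qed.

(** A translation is the composition of two reflections. *)
Lemma lebesgue_translate (c : R) (g : R -> \bar R) :
  (forall x, (0 <= g x)%E) -> measurable_fun setT g ->
  (\int[leb]_x g x = \int[leb]_x g (x + c)%R)%E.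
Proof.
move=> g0 mg; rewrite [LHS](lebesgue_reflect 0)//.
rewrite [LHS](@lebesgue_reflect (- c) (fun x => g (0 - x)%R))//.
- by apply: eq_integral => x _; congr g; ring.
- by apply: measurableT_comp => //; exact: measurable_funB.
Qed.

Lemma cos_gt0_Npihalf (x : R) : x \in `]- (pi / 2), (pi / 2)[ -> 0 < cos x.
Proof. by rewrite in_itv/= => ?; exact: cos_gt0_pihalf. Qed.

Lemma measurable_tan : measurable_fun [set: R] (@tan R).
Proof.
rewrite /tan; apply: measurable_funM; first exact: measurable_sin.
by apply: measurableT_comp (@measurable_inv R) _; exact: measurable_cos.
Qed.

(** The derivative of [tan], restricted to its principal branch so that each real is reached
    once. *)
Definition tan_density (phi : R) : R := \1_(`]- (pi / 2), (pi / 2)[%classic : set R) phi * (cos phi ^+ 2)^-1.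

Lemma measurable_tan_density : measurable_fun setT tan_density.
Proof.
apply: measurable_funM; first exact: measurable_indic.
apply: measurableT_comp (@measurable_inv R) _.
by apply: measurable_funX; exact: measurable_cos.
Qed.

Lemma tan_density_ge0 x : 0 <= tan_density x.
Proof. by rewrite mulr_ge0// invr_ge0 sqr_ge0. Qed.

Lemma lebesgue_tan (y : R) (g : R -> \bar R) : 0 < y ->
  (forall x, (0 <= g x)%E) -> measurable_fun setT g ->
  (\int[leb]_x g x = \int[leb]_phi
    (g (y * tan phi)%R * (y * tan_density phi)%R%:E))%E.
Proof.
move=> y0 g0 mg.
have mtan : measurable_fun [set: R] (fun x : R => y * tan x).
  by apply: measurable_funM => //; exact: measurable_tan.
apply: lebesgue_change => //.
- by apply: measurable_funM => //; exact: measurable_tan_density.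
- by move=> x; rewrite mulr_ge0 ?(ltW y0)// tan_density_ge0.
move=> a b ab.
(* Within the principal branch the preimage of []a, b]] is []A, B]], where the density is the
   derivative of [y * tan x]; the fundamental theorem of calculus gives the mass. *)
pose A := atan (a / y); pose B := atan (b / y).
have AB : A < B by apply: lt_atan; rewrite ltr_pM2r ?invr_gt0.
have AI : A \in `]- (pi / 2), (pi / 2)[ by rewrite in_itv/= atan_gtNpi2 atan_ltpi2.
have BI : B \in `]- (pi / 2), (pi / 2)[ by rewrite in_itv/= atan_gtNpi2 atan_ltpi2.
have sub x : A <= x <= B -> x \in `]- (pi / 2), (pi / 2)[.
  move: AI BI; rewrite !in_itv/= => /andP[A1 _] /andP[_ B2] /andP[Ax xB].
  by rewrite (lt_le_trans A1 Ax) (le_lt_trans xB B2).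
transitivity (\int[leb]_(x in `]A, B]) (y * (cos x ^+ 2)^-1)%:E)%E.
  rewrite integral_mkcond [RHS]integral_mkcond; apply: eq_integral => x _.
  rewrite !patchE.
  have [xI|xI] := boolP (x \in `]- (pi / 2), (pi / 2)[); last first.
    have -> : (x \in `]A, B]%classic) = false.
      apply: memNset => /=; rewrite in_itv/= => /andP[Ax xB].
      by move/negP: xI; apply; apply: sub; rewrite (ltW Ax).
    by case: ifP => // _; rewrite /tan_density indicE memNset ?mul0r ?mulr0//; exact/negP.
  have -> : tan_density x = (cos x ^+ 2)^-1 by rewrite /tan_density indicE mem_set// mul1r.
  have -> : (x \in (fun x => y * tan x) @^-1` `]a, b]) = (a < y * tan x <= b).
    by apply/idP/idP => [/set_mem|h]; [|apply/mem_set]; rewrite /= in_itv.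
  have -> : (x \in `]A, B]%classic) = (A < x <= B).
    by apply/idP/idP => [/set_mem|h]; [|apply/mem_set]; rewrite /= in_itv.
  rewrite [y * _]mulrC.
  rewrite -ltr_pdivrMr// -ler_pdivlMr// -(atanK (a / y)) -(atanK (b / y)).
  by rewrite !ltr_tan// leNgt ltr_tan// -leNgt.
have cos0 x : A <= x <= B -> cos x != 0.
  by move=> /sub/cos_gt0_Npihalf/gt_eqF ->.
have csec x : A <= x <= B -> {for x, continuous (fun x => y * (cos x ^+ 2)^-1)}.
  move=> /cos0 cx; apply: cvgM; first exact: cvg_cst.
  apply: cvgV; first by rewrite sqrf_eq0.
  by apply: cvgM; exact: continuous_cos.
have ctan x : A <= x <= B -> {for x, continuous (fun x => y * tan x)}.
  by move=> /cos0 cx; apply: cvgM; [exact: cvg_cst|exact: continuous_tan].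
have dtan (x : R) : A <= x <= B -> is_derive x 1 (fun x => y * tan x) (y * (cos x ^+ 2)^-1).
  move=> /cos0 cx.
  have := @is_deriveZ _ _ _ tan y x 1 _ (is_derive_tan cx).
  by [].
rewrite integral_itv_obnd_cbnd; last first.
  apply/measurable_EFinP; apply: measurable_funTS.
  apply: measurable_funM => //; apply: measurableT_comp (@measurable_inv R) _.
  by apply: measurable_funX; exact: measurable_cos.
rewrite (@continuous_FTC2 _ _ (fun x => y * tan x))//.
- by rewrite -EFinB !atanK ![y * _]mulrC !divfK ?gt_eqF.
- by apply: continuous_in_subspaceT => x /set_mem; rewrite /= in_itv; exact: csec.
- split.
  + move=> x; rewrite in_itv/= => /andP[Ax xB].
    by have [] := dtan x; rewrite ?(ltW Ax) ?(ltW xB).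
  + by apply: cvg_at_right_filter; apply: ctan; rewrite lexx ltW.
  + by apply: cvg_at_left_filter; apply: ctan; rewrite lexx ltW.
- move=> x; rewrite in_itv/= => /andP[Ax xB].
  by rewrite derive1E; have [|_ ->] := dtan x; rewrite ?(ltW Ax) ?(ltW xB).
Qed.

End change_of_variables.

(** * Polar coordinates for plane integrals *)

Section polar.
Context (R : realType).
Local Notation mR := (measurableTypeR R).
Local Notation leb := (@lebesgue_measure R).
Local Notation leb2 := (leb \x leb)%E.

Let pos (t : R) : R := \1_(`]0, +oo[%classic : set R) t.

Let pos_ge0 t : 0 <= pos t. Proof. by []. Qed.

Let measurable_pos : measurable_fun setT pos.
Proof. exact: measurable_indic. Qed.

Let posE t : 0 < t -> pos t = 1.
Proof. by move=> t0; rewrite /pos indicE mem_set//= in_itv/= t0. Qed.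

Let pos0 t : t <= 0 -> pos t = 0.
Proof.
by move=> t0; rewrite /pos indicE memNset//= in_itv/= andbT; apply/negP; rewrite -leNgt.
Qed.

Let post t : 0 <= pos t * t.
Proof.
by have [t0|t0] := leP t 0; [rewrite pos0// mul0r|rewrite posE// mul1r ltW].
Qed.

Let mpos2 : measurable_fun (setT : set (R * R)) (fun z => pos z.2).
Proof. by apply: measurableT_comp measurable_pos _. Qed.

Let mpost : measurable_fun (setT : set (R * R)) (fun z => pos z.2 * z.2).
Proof. exact: measurable_funM. Qed.

(** The open half turn from [a]: the upper half-plane for [a = 0], the lower one for [a = pi]. *)
Let half (a : R) (theta : R) : R := \1_(`]a, (a + pi)[%classic : set R) theta.

Let mhalf a : measurable_fun (setT : set (R * R)) (fun z => half a z.1).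
Proof. by apply: measurableT_comp measurable_fst; exact: measurable_indic. Qed.

Lemma measurable_polar : measurable_fun (setT : set (R * R)) (fun z => polar z.2 z.1).
Proof.
apply: measurable_fun_pair; apply: measurable_funM => //.
  by apply: measurableT_comp (@measurable_cos R) _.
by apply: measurableT_comp (@measurable_sin R) _.
Qed.

Let K (f : R * R -> \bar R) a (z : R * R) : \bar R :=
  (f (polar z.2 z.1) * (half a z.1 * (pos z.2 * z.2))%R%:E)%E.

Let K0 f a z : (forall z, (0 <= f z)%E) -> (0 <= K f a z)%E.
Proof. by move=> f0; rewrite mule_ge0// lee_fin mulr_ge0. Qed.

Let mK f a : measurable_fun setT f -> measurable_fun setT (K f a).
Proof.
move=> mf; apply: emeasurable_funM; first exact: measurableT_comp mf measurable_polar.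
by apply/measurable_EFinP; apply: measurable_funM.
Qed.

(** Substitutions in one variable suffice: [x = y tan phi] at fixed [y], then, after exchanging the
    integrals, [y = t cos phi] at fixed [phi]. The densities [y / cos^2 phi] and [cos phi] multiply
    to the Jacobian [t]. The half-plane is what keeps [y] and [cos phi] positive. *)
Let integral_upper_halfplane (f : R * R -> \bar R) :
  (forall z, (0 <= f z)%E) -> measurable_fun setT f ->
  (\int[leb2]_z (f z * (pos z.2)%:E) =
   \int[leb]_theta \int[leb]_t K f 0 (theta, t))%E.
Proof.
move=> f0 mf.
pose h (z : R * R) : \bar R :=
  (f (z.1 * tan z.2, z.1)%R * (pos z.1 * z.1 * tan_density z.2)%R%:E)%E.
have h0 z : (0 <= h z)%E.
  by apply: mule_ge0 => //; rewrite lee_fin mulr_ge0 ?tan_density_ge0.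
have mpos1 : measurable_fun (setT : set (R * R)) (fun z => pos z.1).
  by apply: measurableT_comp measurable_pos _.
have mh : measurable_fun setT h.
  apply: emeasurable_funM.
    apply: measurableT_comp mf _; apply: measurable_fun_pair => //.
    by apply: measurable_funM => //; apply: measurableT_comp (@measurable_tan R) _.
  apply/measurable_EFinP; apply: measurable_funM; first exact: measurable_funM.
  by apply: measurableT_comp (@measurable_tan_density R) _.
have mfpos : measurable_fun (setT : set (R * R)) (fun z => f z * (pos z.2)%:E)%E.
  by apply: emeasurable_funM => //; exact/measurable_EFinP.
have mfx y : measurable_fun setT (fun x => f (x, y)).
  by apply: measurableT_comp mf _; apply: measurable_fun_pair.
have fpos0 z : (0 <= f z * (pos z.2)%:E)%E by rewrite mule_ge0// lee_fin.
rewrite [LHS](plane_tonelli2 mfpos fpos0).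
transitivity (\int[leb]_y \int[leb]_phi h (y, phi))%E.
  apply: eq_integral => y _; rewrite /h /=.
  have [y0|y0] := leP y 0.
    by rewrite pos0// !integral0_eq// => x _; rewrite ?mul0r mule0.
  rewrite posE//; under eq_integral do rewrite mule1.
  rewrite (lebesgue_tan y0 _ (mfx y))//.
  by apply: eq_integral => x _; rewrite mul1r.
rewrite [LHS](plane_tonelli mh h0).
pose k (z : R * R) : \bar R := (f (z.2 * sin z.1, z.2 * cos z.1)%R *
  (\1_(`]- (pi / 2), (pi / 2)[%classic : set R) z.1 * (pos z.2 * z.2))%R%:E)%E.
have k0 z : (0 <= k z)%E.
  by apply: mule_ge0 => //; rewrite lee_fin mulr_ge0.
have mk : measurable_fun setT k.
  apply: emeasurable_funM.
    apply: measurableT_comp mf _; apply: measurable_fun_pair; apply: measurable_funM => //.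
      by apply: measurableT_comp (@measurable_sin R) _.
    by apply: measurableT_comp (@measurable_cos R) _.
  apply/measurable_EFinP; apply: measurable_funM => //.
  by apply: measurableT_comp measurable_fst; exact: measurable_indic.
transitivity (\int[leb]_phi \int[leb]_t k (phi, t))%E.
  apply: eq_integral => phi _; rewrite /h /k /= /tan_density.
  have [phiI|phiI] := boolP (phi \in `]- (pi / 2), (pi / 2)[); last first.
    have -> : \1_(`]- (pi / 2), (pi / 2)[%classic : set R) phi = 0 :> R.
      by rewrite indicE memNset//; exact/negP.
    by rewrite !integral0_eq// => x _; rewrite ?mul0r ?mulr0 ?mule0.
  have -> : \1_(`]- (pi / 2), (pi / 2)[%classic : set R) phi = 1 :> R.
    by rewrite indicE mem_set.
  have c0 := cos_gt0_Npihalf phiI.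
  rewrite (lebesgue_scale c0); last 2 first.
  - by move=> y; rewrite mule_ge0// lee_fin mulr_ge0// mul1r invr_ge0 sqr_ge0.
  - apply: emeasurable_funM.
      apply: measurableT_comp mf _; apply: measurable_fun_pair => //.
      exact: measurable_funM.
    by apply/measurable_EFinP; apply: measurable_funM => //; apply: measurable_funM.
  apply: eq_integral => t _; rewrite /tan -muleA -EFinM !mul1r.
  have -> : pos (cos phi * t) = pos t.
    have [t0|t0] := leP t 0; last by rewrite !posE// mulr_gt0.
    by rewrite !pos0// mulr_ge0_le0// ltW.
  have -> : cos phi * t * (sin phi / cos phi) = t * sin phi.
    by field; rewrite gt_eqF.
  by rewrite [cos phi * t]mulrC; congr (f _ * _%:E)%E; field; rewrite gt_eqF.
(* [phi] is the angle from the second axis, [pi / 2 - phi] the one from the first. *)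
rewrite (@lebesgue_reflect R (pi / 2) (fun phi => \int[leb]_t k (phi, t))%E); last 2 first.
- by move=> x; exact: integral_ge0.
- exact: measurable_plane_integral1.
apply: eq_integral => theta _; apply: eq_integral => t _; rewrite /k /K /polar/=.
rewrite sinB cosB sin_pihalf cos_pihalf !mul0r !mul1r subr0 add0r.
congr (_ * (_ * _)%:E)%E; rewrite /half !indicE; congr ((nat_of_bool _)%:R).
apply/idP/idP => /set_mem/=; rewrite in_itv/= => th; apply/mem_set; rewrite /= in_itv/=;
  have := pi_gt0 R; lra.
Qed.

(** The symmetry through the origin exchanges the half-planes and shifts the angle by [pi]. *)
Let integral_lower_halfplane (f : R * R -> \bar R) :
  (forall z, (0 <= f z)%E) -> measurable_fun setT f ->
  (\int[leb2]_z (f z * (pos (- z.2))%:E) =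
   \int[leb]_theta \int[leb]_t K f pi (theta, t))%E.
Proof.
move=> f0 mf.
pose g (z : R * R) := f (- z.1, - z.2).
have g0 z : (0 <= g z)%E by exact: f0.
have mg : measurable_fun setT g.
  by apply: measurableT_comp mf _; apply: measurable_fun_pair; apply: measurable_funN.
have mfpos : measurable_fun (setT : set (R * R)) (fun z => f z * (pos (- z.2))%:E)%E.
  apply: emeasurable_funM => //; apply/measurable_EFinP.
  by apply: measurableT_comp measurable_pos _; exact: measurable_funN.
have fpos0 z : (0 <= f z * (pos (- z.2))%:E)%E by rewrite mule_ge0// lee_fin.
have mgpos : measurable_fun (setT : set (R * R)) (fun z => g z * (pos z.2)%:E)%E.
  by apply: emeasurable_funM => //; exact/measurable_EFinP.
have gpos0 z : (0 <= g z * (pos z.2)%:E)%E by rewrite mule_ge0// lee_fin.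
transitivity (\int[leb2]_z (g z * (pos z.2)%:E))%E.
  rewrite [LHS](plane_tonelli2 mfpos fpos0) [RHS](plane_tonelli2 mgpos gpos0).
  rewrite [LHS](@lebesgue_reflect R 0 (fun y => \int[leb]_x (f (x, y) * (pos (- y))%:E))%E).
  - apply: eq_integral => y _.
    rewrite [LHS](@lebesgue_reflect R 0 (fun x => f (x, 0 - y)%R * (pos (- (0 - y)))%:E)%E).
    + by apply: eq_integral => x _; rewrite /g /= !sub0r opprK.
    + by move=> x; rewrite mule_ge0// lee_fin.
    + apply: emeasurable_funM => //; apply: measurableT_comp mf _.
      exact: measurable_fun_pair.
  - by move=> y; apply: integral_ge0 => x _; rewrite mule_ge0// lee_fin.
  - exact: (measurable_plane_integral2 mfpos fpos0).
rewrite (integral_upper_halfplane g0 mg).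
have Kf0 z : (0 <= K f pi z)%E by exact: K0.
have mKf := mK pi mf.
rewrite [RHS](@lebesgue_translate R pi (fun theta => \int[leb]_t K f pi (theta, t))%E).
- apply: eq_integral => theta _; apply: eq_integral => t _; rewrite /K /g /polar/=.
  rewrite cosDpi sinDpi !mulrN; congr (_ * (_ * _)%:E)%E.
  rewrite /half !indicE; congr ((nat_of_bool _)%:R).
  apply/idP/idP => /set_mem/=; rewrite in_itv/= => th; apply/mem_set; rewrite /= in_itv/=.
    by lra.
  by lra.
- by move=> x; exact: integral_ge0.
- exact: measurable_plane_integral1.
Qed.

Theorem integral_polar (f : R * R -> \bar R) :
  (forall z, (0 <= f z)%E) -> measurable_fun setT f ->
  (\int[leb2]_z f z =
   \int[leb]_(theta in `[0%R, (2 * pi)%R])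
     \int[leb]_(t in `[0%R, +oo[) (f (polar t theta) * t%:E))%E.
Proof.
move=> f0 mf.
have mfp : measurable_fun (setT : set (R * R)) (fun z => f z * (pos z.2)%:E)%E.
  by apply: emeasurable_funM => //; exact/measurable_EFinP.
have mfn : measurable_fun (setT : set (R * R)) (fun z => f z * (pos (- z.2))%:E)%E.
  apply: emeasurable_funM => //; apply/measurable_EFinP.
  by apply: measurableT_comp measurable_pos _; exact: measurable_funN.
transitivity (\int[leb2]_z (f z * (pos z.2)%:E + f z * (pos (- z.2))%:E))%E.
  (* The first axis, a null set: it is the only place where both [pos] factors vanish. *)
  pose Z := [set z : R * R | z.2 = 0].
  have mZ : measurable Z.
    rewrite (_ : Z = setT `*` [set 0]); first exact: measurableX.
    by apply/seteqP; split => -[x y] //= [].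
  apply: (ge0_ae_eq_integral measurableT).
  - exact: mf.
  - by apply: emeasurable_funD; [exact: mfp|exact: mfn].
  - by move=> z _.
  - by move=> z _; rewrite adde_ge0// mule_ge0// lee_fin.
  - exists Z; split.
    + exact: mZ.
    + rewrite -[LHS]/(\int[leb]_x leb (xsection Z x))%E integral0_eq// => x _.
      rewrite (_ : xsection Z x = [set 0]) ?lebesgue_measure_set1//.
      by apply/seteqP; split => [y|_ ->]; rewrite /xsection/=; [move/set_mem|apply/mem_set].
    + move=> z /= /not_implyP[_]; apply: contra_notP => z0.
      have [zn|zp|//] := ltgtP z.2 0.
        by rewrite pos0 ?(ltW zn)// posE ?oppr_gt0// mule0 add0e mule1.
      by rewrite posE// pos0 ?oppr_le0 ?(ltW zp)// mule0 adde0 mule1.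
rewrite ge0_integralD//; last 2 first.
- by move=> z _; rewrite mule_ge0// lee_fin.
- by move=> z _; rewrite mule_ge0// lee_fin.
rewrite integral_upper_halfplane// integral_lower_halfplane//.
have Kf0 a z : (0 <= K f a z)%E by exact: K0.
have mKf a := mK a mf.
rewrite -ge0_integralD//; last 4 first.
- by move=> z _; exact: integral_ge0.
- exact: (measurable_plane_integral1 (mKf 0) (Kf0 0)).
- by move=> z _; exact: integral_ge0.
- exact: (measurable_plane_integral1 (mKf pi) (Kf0 pi)).
pose G0 (z : R * R) := (f (polar z.2 z.1) * (pos z.2 * z.2)%R%:E)%E.
have G0_ge0 z : (0 <= G0 z)%E by rewrite mule_ge0// lee_fin.
have mG0 : measurable_fun setT G0.
  apply: emeasurable_funM; first exact: measurableT_comp mf measurable_polar.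
  exact/measurable_EFinP.
pose G theta := (\int[leb]_t G0 (theta, t))%E.
have G_ge0 theta : (0 <= G theta)%E by exact: integral_ge0.
have mG : measurable_fun setT G by exact: (measurable_plane_integral1 mG0 G0_ge0).
transitivity (\int[leb]_(theta in `[0%R, (2 * pi)%R]) G theta)%E; last first.
  apply: eq_integral => theta _; rewrite [RHS]integral_mkcond.
  apply: eq_integral => t _; rewrite patchE.
  have [t0|t0|t0] := ltgtP t 0.
  - rewrite memNset ?/G0/= ?pos0 ?(ltW t0) ?mul0r ?mule0//.
    by rewrite in_itv/= andbT; apply/negP; rewrite -ltNge.
  - by rewrite mem_set ?/G0/= ?posE ?mul1r// in_itv/= ltW.
  - by rewrite t0 mem_set ?/G0/= ?mulr0 ?mule0// in_itv/= lexx.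
rewrite [RHS]integral_mkcond.
(* The two open half turns fill [[0, 2 pi]] except for these three angles. *)
pose N : set mR := [set 0; pi; 2 * pi].
have mN : measurable N by do 2 (apply: measurableU => //).
apply: (ge0_ae_eq_integral measurableT).
- apply: emeasurable_funD.
    exact: (measurable_plane_integral1 (mKf 0) (Kf0 0)).
  exact: (measurable_plane_integral1 (mKf pi) (Kf0 pi)).
- apply/(measurable_restrictT G) => //; exact: measurable_funTS.
- by move=> z _; rewrite adde_ge0//; exact: integral_ge0.
- by move=> z _; rewrite patchE; case: ifP.
exists N; split.
- exact: mN.
- by apply: countable_lebesgue_measure0; apply: finite_set_countable; rewrite /N !finite_setU.
move=> theta /= /not_implyP[_]; apply: contra_notP => thN.
have p0 := pi_gt0 R.
have neq0 : theta != 0 by apply/eqP => h; apply: thN; left; left.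
have neqpi : theta != pi by apply/eqP => h; apply: thN; left; right.
have neq2pi : theta != 2 * pi by apply/eqP => h; apply: thN; right.
have kE a : (\int[leb]_t K f a (theta, t) = (half a theta)%:E * G theta)%E.
  rewrite -ge0_integralZl//.
  - by apply: eq_integral => t _; rewrite /K/= EFinM muleCA.
  - exact: measurableT_comp mG0 (measurable_pair1 theta).
  - by rewrite lee_fin.
rewrite !kE patchE -ge0_muleDl ?lee_fin// -EFinD.
have halfE a : half a theta = (a < theta < a + pi)%R%:R.
  rewrite /half indicE; congr ((nat_of_bool _)%:R).
  by apply/idP/idP => [/set_mem|h]; [|apply/mem_set]; rewrite /= in_itv.
have -> : (theta \in `[0, (2 * pi)]%classic) = (0 <= theta <= 2 * pi).
  by apply/idP/idP => [/set_mem|h]; [|apply/mem_set]; rewrite /= in_itv.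
rewrite !halfE -natrD.
have -> : ((0 < theta < 0 + pi)%R + (pi < theta < pi + pi)%R)%N = (0 <= theta <= 2 * pi) :> nat.
  rewrite (_ : 2 * pi = pi + pi) in neq2pi *; last by ring.
  rewrite add0r; move: neq0 neqpi neq2pi; have [t0|t0|//] := ltgtP 0 theta => /=; last first.
    by rewrite (_ : (pi < theta) = false)//; apply/negP; lra.
  have [t1|t1|//] := ltgtP theta pi => /=.
    by rewrite (_ : (theta <= pi + pi) = true)//; lra.
  by have [t2|t2|//] := ltgtP theta (pi + pi).
by case: ifP; rewrite ?mul1e ?mul0e.
Qed.

End polar.

(** * Measurability of the link events *)

Section links.
Context (R : realType).

(* In the frame whose first axis is the direction of the blockage, a point of the
   link is on the blockage iff its second coordinate, relative to the center,
   vanishes and its first one is at most half the length in absolute value. *)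
Definition link_meets (x c m : R * R) : bool :=
  let al := x.2 * cos m.2 - x.1 * sin m.2 in
  let be := c.2 * cos m.2 - c.1 * sin m.2 in
  let ga := x.1 * cos m.2 + x.2 * sin m.2 in
  let de := c.1 * cos m.2 + c.2 * sin m.2 in
  ((al != 0) && ((0 <= be * al^-1) && (be * al^-1 <= 1)) &&
    (`|ga * (be * al^-1) - de| <= m.1 * 2^-1))
  || ((al == 0) && (be == 0) && (0 <= m.1) &&
      ((Num.min 0 ga <= de + m.1 * 2^-1) && (de - m.1 * 2^-1 <= Num.max 0 ga))).

(** Replaces the intersection of two segments by finitely many comparisons of measurable functions
    of endpoint, center and mark, which makes link events measurable jointly in the endpoint and the
    outcome. *)
Lemma link_meetsP x c m :
  link_segment x `&` blockage_segment c m !=set0 <-> link_meets x c m.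
Proof.
have cs : cos m.2 ^+ 2 + sin m.2 ^+ 2 = 1 by exact: cos2Dsin2.
rewrite /link_meets /link_segment /blockage_segment.
set C := cos m.2 in cs *; set S := sin m.2 in cs *.
set al := x.2 * C - x.1 * S; set be := c.2 * C - c.1 * S.
set ga := x.1 * C + x.2 * S; set de := c.1 * C + c.2 * S.
(* [a] is the parameter along the link. In the frame of the blockage the second coordinates must
   agree and the first ones differ by at most half the length. *)
apply: (@iff_trans _ (exists a, [/\ 0 <= a <= 1, al * a = be & `|ga * a - de| <= m.1 / 2])).
  split.
    move=> [_ [[a /= aI <-] [u /= uI [E1 E2]]]]; exists a.
    move: aI uI; rewrite !in_itv/= => aI uI; split => //.
      have -> : al * a = (a * x.2) * C - (a * x.1) * S by rewrite /al; ring.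
      by rewrite -E1 -E2 /be; ring.
    have -> : ga * a - de = u; last by rewrite ler_norml.
    have -> : ga * a - de = (a * x.1) * C + (a * x.2) * S - de by rewrite /ga; ring.
    by rewrite -E1 -E2 /de -[RHS]mulr1 -cs; ring.
  move=> [a [aI ab hu]]; exists (a * x.1, a * x.2); split.
    by exists a => //=; rewrite in_itv.
  exists (ga * a - de); first by rewrite /= in_itv/= -ler_norml.
  have p0 : (a * x.2 - c.2) * C - (a * x.1 - c.1) * S = 0.
    have -> : (a * x.2 - c.2) * C - (a * x.1 - c.1) * S = al * a - be.
      by rewrite /al /be; ring.
    by rewrite ab subrr.
  congr pair; apply/eqP; rewrite -subr_eq0; apply/eqP.
    rewrite (_ : _ - _ = (ga * a - de) * C - (a * x.1 - c.1)); last by ring.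
    rewrite -[a * x.1 - c.1]mulr1 -cs.
    transitivity (S * ((a * x.2 - c.2) * C - (a * x.1 - c.1) * S)).
      by rewrite /ga /de; ring.
    by rewrite p0 mulr0.
  rewrite (_ : _ - _ = (ga * a - de) * S - (a * x.2 - c.2)); last by ring.
  rewrite -[a * x.2 - c.2]mulr1 -cs.
  transitivity (- C * ((a * x.2 - c.2) * C - (a * x.1 - c.1) * S)).
    by rewrite /ga /de; ring.
  by rewrite p0 mulr0.
(* If [al] is nonzero the link can meet the line of the blockage only at the parameter [be / al]. If
   [al] is zero the two directions are parallel, and two intervals of one line have to meet. *)
have [al0|al0] := eqVneq al 0 => /=; last first.
  rewrite orbF; split.
    move=> [a [/andP[a0 a1] ab h]].
    have aE : be / al = a by rewrite -ab mulrAC mulfV// mul1r.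
    by rewrite aE a0 a1.
  move=> /andP[bI h]; exists (be / al); split => //.
  by rewrite mulrC divfK.
have min0 : Num.min 0 ga <= 0 by rewrite ge_min lexx.
have minga : Num.min 0 ga <= ga by rewrite ge_min lexx orbT.
have max0 : 0 <= Num.max 0 ga by rewrite le_max lexx.
have maxga : ga <= Num.max 0 ga by rewrite le_max lexx orbT.
split.
  move=> [a [/andP[a0 a1]]]; rewrite al0 mul0r => <- h; rewrite eqxx/=.
  have m0 : 0 <= m.1 by move: (le_trans (normr_ge0 _) h); rewrite pmulr_lge0 ?invr_gt0.
  move: h; rewrite m0/= ler_norml => /andP[h1 h2].
  have lo : Num.min 0 ga <= ga * a.
    by have [g0|g0] := leP 0 ga; [rewrite mulr_ge0|rewrite ler_niMr// ltW].
  have up : ga * a <= Num.max 0 ga.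
    by have [g0|g0] := leP 0 ga; [rewrite ler_piMr|rewrite mulr_le0_ge0// ltW].
  by apply/andP; split; lra.
move=> /andP[/andP[/eqP be0 m0] /andP[h1 h2]].
(* [y] stands for [ga * a], which runs over the interval between 0 and [ga]. *)
suff [y [y0 y1 hy]] : exists y, [/\ Num.min 0 ga <= y, y <= Num.max 0 ga & `|y - de| <= m.1 / 2].
  have [g0|g0] := eqVneq ga 0.
    exists 0; rewrite lexx ler01 mulr0 be0; split => //.
    move: hy; rewrite mulr0; rewrite g0 minxx maxxx in y0 y1.
    by rewrite (_ : y = 0)//; apply/eqP; rewrite eq_le y1 y0.
  exists (y / ga); rewrite al0 be0 mul0r [ga * _]mulrC divfK//; split => //.
  move: y0 y1; have [gp|gn] := leP 0 ga => y0 y1.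
    have {}gp : 0 < ga by rewrite lt_def g0.
    by rewrite divr_ge0 ?(ltW gp)// ler_pdivrMr// mul1r.
  by rewrite ler_ndivlMr// mul0r y1 ler_ndivrMr// mul1r y0.
have m2 : 0 <= m.1 / 2 by rewrite divr_ge0.
(* The witness is the point of that interval closest to [de]. *)
have [d1|d1] := leP de (Num.min 0 ga).
  exists (Num.min 0 ga); split => //; first by rewrite (le_trans min0).
  by rewrite ger0_norm; lra.
have [d2|d2] := leP (Num.max 0 ga) de.
  exists (Num.max 0 ga); split => //; first by rewrite (le_trans min0).
  by rewrite ler0_norm; lra.
exists de; split; [exact: ltW|exact: ltW|by rewrite subrr normr0].
Qed.

Lemma measurable_link_meets d (T : measurableType d) (x c m : T -> R * R) :
  measurable_fun setT x -> measurable_fun setT c -> measurable_fun setT m ->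
  measurable_fun setT (fun z => link_meets (x z) (c z) (m z)).
Proof.
move=> mx mc mm.
have m1 (f : T -> R * R) : measurable_fun setT f -> measurable_fun setT (fun z => (f z).1).
  by move=> mf; exact: measurableT_comp measurable_fst mf.
have m2 (f : T -> R * R) : measurable_fun setT f -> measurable_fun setT (fun z => (f z).2).
  by move=> mf; exact: measurableT_comp measurable_snd mf.
have mcos : measurable_fun setT (fun z => cos (m z).2).
  by apply: measurableT_comp (@measurable_cos R) _; exact: m2.
have msin : measurable_fun setT (fun z => sin (m z).2).
  by apply: measurableT_comp (@measurable_sin R) _; exact: m2.
have mal (f : T -> R * R) : measurable_fun setT f ->
    measurable_fun setT (fun z => (f z).2 * cos (m z).2 - (f z).1 * sin (m z).2).
  by move=> mf; apply: measurable_funB; apply: measurable_funM => //; [exact: m2|exact: m1].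
have mga (f : T -> R * R) : measurable_fun setT f ->
    measurable_fun setT (fun z => (f z).1 * cos (m z).2 + (f z).2 * sin (m z).2).
  by move=> mf; apply: measurable_funD; apply: measurable_funM => //; [exact: m1|exact: m2].
have minv : measurable_fun setT (fun z => ((c z).2 * cos (m z).2 - (c z).1 * sin (m z).2) *
    ((x z).2 * cos (m z).2 - (x z).1 * sin (m z).2)^-1).
  by apply: measurable_funM; [exact: mal|apply: measurableT_comp (@measurable_inv R) _; exact: mal].
have mh : measurable_fun setT (fun z => (m z).1 * 2^-1).
  by apply: measurable_funM => //; exact: m1.
have c0 (k : R) : measurable_fun (setT : set T) (fun=> k) by exact: measurable_cst.
rewrite /link_meets; apply: measurable_or; repeat apply: measurable_and.
- by apply: measurable_neg; apply: measurable_fun_eqr; [exact: mal|exact: c0].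
- by apply: measurable_fun_ler; [exact: c0|exact: minv].
- by apply: measurable_fun_ler; [exact: minv|exact: c0].
- apply: measurable_fun_ler; last exact: mh.
  apply: measurableT_comp; first exact: normr_measurable.
  by apply: measurable_funB; [apply: measurable_funM => //; exact: mga|exact: mga].
- by apply: measurable_fun_eqr; [exact: mal|exact: c0].
- by apply: measurable_fun_eqr; [exact: mal|exact: c0].
- by apply: measurable_fun_ler; [exact: c0|exact: m1].
- apply: measurable_fun_ler; first by apply: measurable_minr; [exact: c0|exact: mga].
  by apply: measurable_funD => //; exact: mga.
- apply: measurable_fun_ler; last by apply: measurable_maxr; [exact: c0|exact: mga].
  by apply: measurable_funB => //; exact: mga.
Qed.

Context d (T : measurableType d) (P : probability T R) (b : blockages R T).

Lemma measurable_link_event2 v :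
  measurable [set z : (R * R) * T | link_event b v z.1 z.2].
Proof.
have mlos : measurable [set z : (R * R) * T | link_event b LoS z.1 z.2].
  rewrite (_ : [set z | _] = \bigcap_n [set z : (R * R) * T |
      link_meets z.1 (bl_center b n z.2) (bl_mark b n z.2) = false]).
    apply: bigcap_measurableType => n _.
    rewrite -[X in measurable X]setTI.
    have mn : measurable_fun setT (fun z : (R * R) * T =>
        link_meets z.1 (bl_center b n z.2) (bl_mark b n z.2)).
      by apply: measurable_link_meets => //; apply: measurableT_comp measurable_snd.
    exact: (mn measurableT [set false]).
  apply/seteqP; split => -[x w] /= h n.
    move=> _; apply/negP => /link_meetsP; rewrite h => -[z []].
  apply/eqP; apply: contraFT (h n I) => /set0P/link_meetsP; exact.
case: v => //.
rewrite (_ : [set z | _] = ~` [set z : (R * R) * T | link_event b LoS z.1 z.2]) //.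
exact: measurableC.
Qed.

Lemma measurable_link_event v x : measurable (link_event b v x).
Proof.
have := measurable_xsection x (measurable_link_event2 v).
congr (measurable _); apply/seteqP; split => w; first by move/xsectionP.
by move=> h; exact/xsectionP.
Qed.

(** The probability is that of a section of a jointly measurable set. *)
Lemma measurable_link_joint s v y :
  measurable_fun setT (fun x => fine (P (link_event b s y `&` link_event b v x))).
Proof.
apply: measurableT_comp => //.
have mA : measurable ([set: R * R] `*` link_event b s y `&`
    [set z : (R * R) * T | link_event b v z.1 z.2]).
  apply: measurableI; last exact: measurable_link_event2.
  by apply: measurableX => //; exact: measurable_link_event.
have := measurable_fun_xsection P mA.
congr (measurable_fun _ _); apply/funext => x /=; congr (P _).
apply/seteqP; split => w; first by move/xsectionP => [[_ /= ?]].
by move=> [? ?]; exact/xsectionP.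
Qed.
End links.

(** * Integrating out the types and fadings of the other stations *)

Section marks.
Context (R : realType) d (T : measurableType d) (P : probability T R).
Context d1 (V : measurableType d1) d2 (W : measurableType d2).
Variables (e : probability W R) (q : bool -> V -> R).
Variables (X : nat -> T -> V) (M : nat -> T -> bool * W).
Hypothesis mX : forall n, measurable_fun setT (X n).
Hypothesis mM : forall n, measurable_fun setT (M n).
Hypothesis mq : forall v, measurable_fun setT (q v).
Hypothesis q0 : forall v x, 0 <= q v x.
Hypothesis hM : forall (n : nat) (G : set T) (D : 'I_n -> set (bool * W)),
  <<s sigma_seq X >> G -> (forall i, measurable (D i)) ->
  P (G `&` [set w | forall i : 'I_n, D i (M i w)]) =
  (\int[P]_(w in G) \prod_(i < n)
     \sum_(v : bool) (q v (X i w))%:E * e [set h | D i (v, h)])%E.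

Variable phi : bool -> V * W -> R.
Hypothesis mphi : forall v, measurable_fun setT (phi v).
Hypothesis phi01 : forall v z, 0 <= phi v z <= 1.

Let bar v x := fine (\int[e]_h (phi v (x, h))%:E)%E.

Let phi_ge0 v z : 0 <= phi v z. Proof. by have /andP[] := phi01 v z. Qed.

Let bar_int v x : (\int[e]_h (phi v (x, h))%:E)%E = (bar v x)%:E /\ 0 <= bar v x <= 1.
Proof.
have i0 : (0 <= \int[e]_h (phi v (x, h))%:E)%E.
  by apply: integral_ge0 => h _; rewrite lee_fin.
have i1 : (\int[e]_h (phi v (x, h))%:E <= 1)%E.
  apply: (@le_trans _ _ (\int[e]_h (cst 1%E h))%E); last first.
    by rewrite integral_cst// mul1e; exact: probability_le1.
  apply: ge0_le_integral => //.
  - by move=> h _; rewrite lee_fin.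
  - by apply/measurable_EFinP; exact: measurableT_comp (mphi v) (measurable_pair1 x).
  - by move=> h _; rewrite lee_fin; have /andP[] := phi01 v (x, h).
have fin : (\int[e]_h (phi v (x, h))%:E)%E \is a fin_num.
  by rewrite ge0_fin_numE// (le_lt_trans i1)// ltry.
by rewrite -!lee_fin fineK// i0 i1.
Qed.

Let mbar v : measurable_fun setT (bar v).
Proof.
apply: measurableT_comp => //.
apply: (@measurable_fun_fubini_tonelli_F _ _ _ _ _ e (fun z => (phi v z)%:E)).
  exact/measurable_EFinP.
by move=> z; rewrite lee_fin.
Qed.

(** The mean of [phi] over the mark of a station at [x]. *)
Let psi x := q true x * bar true x + q false x * bar false x.

Let psi_ge0 x : 0 <= psi x.
Proof.
have b0 v : 0 <= bar v x by have [_ /andP[]] := bar_int v x.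
by rewrite addr_ge0// mulr_ge0.
Qed.

Let mpsi : measurable_fun setT psi.
Proof. by apply: measurable_funD; exact: measurable_funM. Qed.

Let k (D : set (bool * W)) x := q true x * fine (e [set h | D (true, h)]) +
  q false x * fine (e [set h | D (false, h)]).

Let mslice (D : set (bool * W)) v : measurable D -> measurable [set h | D (v, h)].
Proof.
move=> mD; rewrite -[X in measurable X]setTI.
exact: (@measurable_pair1 _ _ bool W v measurableT).
Qed.

Let kE (D : set (bool * W)) x : measurable D ->
  (\sum_(v : bool) (q v x)%:E * e [set h | D (v, h)] = (k D x)%:E)%E.
Proof.
move=> mD; rewrite big_bool/= /k EFinD !EFinM !fineK//;
  by apply: fin_num_measure; exact: mslice.
Qed.

Let k_ge0 D x : 0 <= k D x.
Proof. by rewrite addr_ge0// mulr_ge0// fine_ge0. Qed.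

Let mk D : measurable_fun setT (k D).
Proof. by apply: measurable_funD; exact: measurable_funM. Qed.

Let pt (w : T) i := phi (M i w).1 (X i w, (M i w).2).

Let ptE w i : pt w i = \1_[set w | (M i w).1 = true] w * phi true (X i w, (M i w).2)
   + \1_[set w | (M i w).1 = false] w * phi false (X i w, (M i w).2).
Proof.
rewrite /pt !indicE; case E : (M i w).1.
  by rewrite mem_set// memNset ?mul1r ?mul0r ?addr0//= E.
by rewrite [in X in _ = _ + X]mem_set// memNset ?mul1r ?mul0r ?add0r//= E.
Qed.

Let mtype i v : measurable [set w | (M i w).1 = v].
Proof.
rewrite -[X in measurable X]setTI.
have m1 : measurable_fun setT (fun w => (M i w).1).
  exact: measurableT_comp measurable_fst (mM i).
exact: (m1 measurableT [set v]).
Qed.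

Let mXM i : measurable_fun setT (fun w => (X i w, (M i w).2)).
Proof.
by apply: measurable_fun_pair => //; exact: measurableT_comp measurable_snd (mM i).
Qed.

Let mpt i : measurable_fun setT (fun w => pt w i).
Proof.
under eq_fun do rewrite ptE.
apply: measurable_funD; apply: measurable_funM.
- exact/measurable_indic/mtype.
- exact: measurableT_comp (mphi true) (mXM i).
- exact/measurable_indic/mtype.
- exact: measurableT_comp (mphi false) (mXM i).
Qed.

(** The hypothesis treats mark events jointly with an event [G] on the positions. Induction on [j]
    turns the first [j] mark indicators into values of [phi]. [G] stays arbitrary because the step
    intersects it with an event on the position of station [j]: the identity on rectangles, from
    which [phi] of position and fading is integrated, needs both coordinates. *)
Lemma integrate_out_marks n :
  (\int[P]_w (\prod_(l < n) phi (M l w).1 (X l w, (M l w).2))%:E =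
   \int[P]_w (\prod_(l < n) (q true (X l w) * fine (\int[e]_h (phi true (X l w, h))%:E) +
                q false (X l w) * fine (\int[e]_h (phi false (X l w, h))%:E)))%:E)%E.
Proof.
pose F (j : nat) (D : 'I_n -> set (bool * W)) (i : 'I_n) w : R :=
  if (i < j)%N then pt w i else \1_(D i) (M i w).
pose Gf (j : nat) (D : 'I_n -> set (bool * W)) (i : 'I_n) w : R :=
  if (i < j)%N then psi (X i w) else k (D i) (X i w).
have F0 j D i w : 0 <= F j D i w by rewrite /F; case: ifP => // _; exact: phi_ge0.
have G0 j D i w : 0 <= Gf j D i w by rewrite /Gf; case: ifP.
have mF j D i : (forall i, measurable (D i)) -> measurable_fun setT (F j D i).
  move=> mD; rewrite /F; case: (i < j)%N; first exact: mpt.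
  by apply: measurableT_comp (mM i); exact: measurable_indic.
have mG j D i : measurable_fun setT (Gf j D i).
  by rewrite /Gf; case: (i < j)%N; exact: measurableT_comp (mX i).
have sG G : <<s sigma_seq X >> G -> measurable G.
  apply: smallest_sub; first exact: sigma_algebra_measurable.
  move=> A [l _ [B mB <-]]; exact: (mX l measurableT).
have key j : (j <= n)%N -> forall D, (forall i, measurable (D i)) ->
    forall G, <<s sigma_seq X >> G ->
    (\int[P]_w (\1_G w * \prod_(i < n) F j D i w)%:E =
     \int[P]_w (\1_G w * \prod_(i < n) Gf j D i w)%:E)%E.
  elim: j => [_|j ih jn] D mD G sGG.
    transitivity (P (G `&` [set w | forall i : 'I_n, D i (M i w)])).
      rewrite -[in RHS](setIT (_ `&` _)) -integral_indic//; last first.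
        apply: measurableI; first exact: sG.
        rewrite (_ : [set w | _] = \bigcap_(i in [set: 'I_n]) (M i @^-1` D i)); last first.
          by apply/seteqP; split => w /=; [move=> h i _|move=> h i]; exact: h.
        apply: fin_bigcap_measurable => // i _.
        by rewrite -[X in measurable X]setTI; exact: (mM i measurableT).
      apply: eq_integral => w _; congr EFin; rewrite indicI/=; congr (_ * _).
      rewrite [RHS]indicE.
      have [h|h] := pselect (forall i : 'I_n, D i (M i w)).
        by rewrite mem_set// big1// => i _; rewrite /F/= indicE mem_set.
      rewrite memNset//; move/existsNP: h => [i h]; rewrite (bigD1 i)//=.
      by rewrite /F/= indicE memNset ?mul0r.
    rewrite hM// integral_mkcond; apply: eq_integral => w _.
    rewrite patchE indicE; case: ifPn => wG; last by rewrite mul0r.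
    by rewrite mul1r -prodEFin; apply: eq_bigr => i _; rewrite kE.
  pose jj := Ordinal jn.
  pose upd D' i := if i == jj then D' else D i.
  have mupd D' : measurable D' -> forall i, measurable (upd D' i).
    by move=> mD' i; rewrite /upd; case: ifP.
  pose rF w := \1_G w * \prod_(i < n | i != jj) F j D i w.
  pose rG w := \1_G w * \prod_(i < n | i != jj) Gf j D i w.
  have rF0 w : 0 <= rF w by rewrite mulr_ge0// prodr_ge0.
  have rG0 w : 0 <= rG w by rewrite mulr_ge0// prodr_ge0.
  have mrF : measurable_fun setT rF.
    apply: measurable_funM; first by apply: measurable_indic; exact: sG.
    by under eq_fun do rewrite -big_filter; apply: measurable_prod => i _; exact: mF.
  have mrG : measurable_fun setT rG.
    apply: measurable_funM; first by apply: measurable_indic; exact: sG.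
    by under eq_fun do rewrite -big_filter; apply: measurable_prod => i _; exact: mG.
  have updF D' w : \prod_(i < n | i != jj) F j (upd D') i w = \prod_(i < n | i != jj) F j D i w.
    by apply: eq_bigr => i ij; rewrite /F /upd (negbTE ij).
  have updG D' w : \prod_(i < n | i != jj) Gf j (upd D') i w = \prod_(i < n | i != jj) Gf j D i w.
    by apply: eq_bigr => i ij; rewrite /Gf /upd (negbTE ij).
  have succF w : \1_G w * \prod_(i < n) F j.+1 D i w = rF w * pt w jj.
    rewrite (bigD1 jj)//= {1}/F ltnSn [pt w j * _]mulrC mulrA; congr (_ * _ * _).
    apply: eq_bigr => i ij; rewrite /F ltnS leq_eqVlt.
    by rewrite (_ : (i == j :> nat) = false)//; exact: negbTE.
  have succG w : \1_G w * \prod_(i < n) Gf j.+1 D i w = rG w * psi (X jj w).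
    rewrite (bigD1 jj)//= {1}/Gf ltnSn [psi _ * _]mulrC mulrA; congr (_ * _ * _).
    apply: eq_bigr => i ij; rewrite /Gf ltnS leq_eqVlt.
    by rewrite (_ : (i == j :> nat) = false)//; exact: negbTE.
  (* The other factors times the type of station [jj]: as an indicator in [Y], as a probability in
     [Z]. *)
  pose Y v w := rF w * \1_[set w | (M jj w).1 = v] w.
  pose Z v w := rG w * q v (X jj w).
  have Y0 v w : 0 <= Y v w by rewrite mulr_ge0.
  have Z0 v w : 0 <= Z v w by rewrite mulr_ge0.
  have mY v : measurable_fun setT (Y v).
    by apply: measurable_funM => //; exact: measurable_indic.
  have mZ v : measurable_fun setT (Z v).
    by apply: measurable_funM => //; exact: measurableT_comp (mX jj).
  (* This is the induction hypothesis for [G] cut by the position of station [jj], with mark set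
     [[set v]] times [D'] at [jj]. *)
  have rect v B D' : measurable B -> measurable D' ->
      (\int[P]_(w in X jj @^-1` B `&` (fun w => (M jj w).2) @^-1` D') (Y v w)%:E =
       (\int[P]_(w in X jj @^-1` B) (Z v w)%:E) * e D')%E.
    move=> mB mD'.
    have mvD : measurable ([set v] `*` D' : set (bool * W)) by exact: measurableX.
    have sGB : <<s sigma_seq X >> (G `&` X jj @^-1` B).
      apply: (@measurableI _ (g_sigma_algebraType (sigma_seq X))) => //; apply: sub_sigma_algebra; exists jj => //.
      by exists B => //; rewrite setTI.
    have eE : e D' = (fine (e D'))%:E by rewrite fineK// fin_num_measure.
    transitivity (\int[P]_w (\1_(G `&` X jj @^-1` B) w *
        \prod_(i < n) F j (upd ([set v] `*` D')) i w)%:E)%E.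
      rewrite integral_mkcond; apply: eq_integral => w _.
      rewrite patchE in_setI [in RHS](bigD1 jj)//= updF {1}/F ltnn /upd eqxx indicI/=.
      rewrite /Y /rF [\1_(X _ @^-1` _) _]indicE [\1_(_ `*` _) _]indicE.
      have [wB|wB] := boolP (w \in X jj @^-1` B); last by rewrite mulr0 mul0r.
      have [wD|wD] /= := boolP (w \in (fun w => (M jj w).2) @^-1` D').
        congr EFin; rewrite mulr1 -[LHS]mulrA; congr (_ * _); rewrite mulrC indicE.
        congr ((nat_of_bool _)%:R * _); apply/idP/idP => /set_mem h; apply/mem_set => /=.
          by split => //; exact: set_mem wD.
        by case: h.
      rewrite [M j w \in _]memNset ?mul0r ?mulr0// => -[_ h].
      by move/negP: wD; apply; apply/mem_set.
    rewrite ih ?(ltnW jn)//; last exact: mupd.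
    have -> : (\int[P]_(w in X jj @^-1` B) (Z v w)%:E =
        \int[P]_w (\1_(X jj @^-1` B) w * Z v w)%:E)%E.
      rewrite integral_mkcond; apply: eq_integral => w _.
      by rewrite patchE indicE; case: ifP; rewrite ?mul1r ?mul0r.
    rewrite [in RHS]muleC eE -ge0_integralZl//; last 3 first.
    - apply/measurable_EFinP; apply: measurable_funM => //; apply: measurable_indic.
      by rewrite -[X in measurable X]setTI; exact: (mX jj measurableT).
    - by move=> w _; rewrite lee_fin mulr_ge0.
    - by rewrite lee_fin fine_ge0.
    apply: eq_integral => w _; rewrite [in LHS](bigD1 jj)//= updG {1}/Gf ltnn /upd eqxx.
    rewrite indicI/= -EFinM /Z /rG; congr EFin.
    have -> : k ([set v] `*` D') (X j w) = q v (X jj w) * fine (e D').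
      have sliceE u : [set h | ([set v] `*` D') (u, h)] = if u == v then D' else set0.
        have [->|/eqP uv] := eqVneq u v; first by apply/seteqP; split => h // [].
        by apply/seteqP; split => h // [].
      rewrite /k !sliceE; case: (v) => /=; rewrite measure0 mulr0; first exact: addr0.
      exact: add0r.
    by ring.
  have step v : (\int[P]_w (Y v w * phi v (X jj w, (M jj w).2))%:E =
                 \int[P]_w (Z v w * bar v (X jj w))%:E)%E.
    transitivity (\int[P]_w ((phi v (X jj w, (M jj w).2))%:E * (Y v w)%:E))%E.
      by apply: eq_integral => w _; rewrite -EFinM mulrC.
    rewrite (@ge0_integral_independent _ _ _ _ _ _ R P e (X jj) (fun w => (M jj w).2)
      (Y v) (Z v) (fun z => (phi v z)%:E) (mX jj)
      (measurableT_comp measurable_snd (mM jj)) (mY v) (mZ v) (Y0 v) (Z0 v) _ (rect v))//;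
      last exact/measurable_EFinP.
    - apply: eq_integral => w _; rewrite (bar_int v (X jj w)).1 -EFinM mulrC; congr EFin.
    (* The mass of [Z v] equals that of [Y v], and [Y v] is at most 1. *)
    - have := rect v setT setT measurableT measurableT.
      rewrite probability_setT mule1 => <-.
      apply: (@le_lt_trans _ _ (\int[P]_w (cst 1%E w))%E); last first.
        by rewrite integral_cst// mul1e; apply: le_lt_trans (probability_le1 _ _) (ltry _).
      rewrite !preimage_setT setIT; apply: ge0_le_integral => //.
      + by move=> w _; rewrite lee_fin.
      + by apply/measurable_EFinP.
      + move=> w _; rewrite lee_fin /Y /rF.
        have i1 A z : \1_A z <= 1 :> R by rewrite indicE; case: (_ \in _).
        have p1 : \prod_(i < n | i != jj) F j D i w <= 1.
          apply: prodr_ile1 => i _; rewrite F0 /F/=; case: ifP => // _.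
          by have /andP[] := phi01 (M i w).1 (X i w, (M i w).2).
        by apply: mulr_ile1; [exact: rF0|by []|apply: mulr_ile1 => //; exact: prodr_ge0|].
    - by move=> z; rewrite lee_fin.
  under eq_integral do rewrite succF.
  under [RHS]eq_integral do rewrite succG.
  transitivity (\int[P]_w ((Y true w * phi true (X jj w, (M jj w).2))%:E +
                         (Y false w * phi false (X jj w, (M jj w).2))%:E))%E.
    apply: eq_integral => w _; rewrite -EFinD; congr EFin.
    by rewrite ptE /Y; ring.
  have mYphi v : measurable_fun setT (fun w => Y v w * phi v (X jj w, (M jj w).2)).
    by apply: measurable_funM => //; exact: measurableT_comp (mphi v) (mXM jj).
  have mZbar v : measurable_fun setT (fun w => Z v w * bar v (X jj w)).
    by apply: measurable_funM => //; exact: measurableT_comp (mbar v) (mX jj).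
  rewrite ge0_integralD//; first last.
  - exact/measurable_EFinP.
  - by move=> w _; rewrite lee_fin mulr_ge0.
  - exact/measurable_EFinP.
  - by move=> w _; rewrite lee_fin mulr_ge0.
  rewrite !step -ge0_integralD//; first last.
  - exact/measurable_EFinP.
  - by move=> w _; rewrite lee_fin mulr_ge0//; have [_ /andP[]] := bar_int false (X jj w).
  - exact/measurable_EFinP.
  - by move=> w _; rewrite lee_fin mulr_ge0//; have [_ /andP[]] := bar_int true (X jj w).
  apply: eq_integral => w _; rewrite -EFinD; congr EFin.
  by rewrite /Z /psi; ring.
have := key n (leqnn n) (fun=> setT) (fun=> measurableT) setT
  (@measurableT _ (g_sigma_algebraType (sigma_seq X))).
rewrite /F /Gf; under eq_integral do under eq_bigr do rewrite ltn_ord.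
under [X in _ = X -> _]eq_integral do under eq_bigr do rewrite ltn_ord.
under eq_integral do rewrite indicT mul1r.
by under [X in _ = X -> _]eq_integral do rewrite indicT mul1r.
Qed.

End marks.

(** * Distance and angle; conditional laws *)

Section polar_coordinates.
Context (R : realType).
Implicit Types (x : R * R) (t theta : R).

Lemma dist_ge0 x : 0 <= dist x. Proof. exact: sqrtr_ge0. Qed.

Lemma sqr_dist x : dist x ^+ 2 = x.1 ^+ 2 + x.2 ^+ 2.
Proof. by rewrite sqr_sqrtr// addr_ge0// sqr_ge0. Qed.

Lemma measurable_dist : measurable_fun [set: R * R] (@dist R).
Proof.
apply: measurableT_comp (@measurable_sqrt R) _.
by apply: measurable_funD; exact: measurable_funX.
Qed.

Lemma dist_polar t theta : 0 <= t -> dist (polar t theta) = t.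
Proof.
move=> t0; rewrite /dist /polar/= !exprMn -mulrDr cos2Dsin2 mulr1.
by rewrite sqrtr_sqr ger0_norm.
Qed.

Lemma polar_dist_angle x : polar (dist x) (angle x) = x.
Proof.
have [d0|d0] := eqVneq (dist x) 0.
  rewrite /polar d0 !mul0r; have := sqr_dist x.
  rewrite d0 expr0n/= => /esym/eqP; rewrite paddr_eq0 ?sqr_ge0// !sqrf_eq0.
  by case: x {d0} => a b /= /andP[/eqP -> /eqP ->].
have dp : 0 < dist x by rewrite lt_def d0 dist_ge0.
set y := x.1 / dist x.
have yE : 1 - y ^+ 2 = (x.2 / dist x) ^+ 2.
  rewrite /y !exprMn exprVn sqr_dist.
  have dd : x.1 ^+ 2 + x.2 ^+ 2 != 0 by rewrite -sqr_dist sqrf_eq0.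
  by field.
have yI : -1 <= y <= 1.
  by rewrite -ler_norml -(@expr_le1 _ 2)// real_normK ?num_real// -subr_ge0 yE sqr_ge0.
have cosy : cos (acos y) = y by rewrite acosK// in_itv.
have siny : sin (acos y) = `|x.2| / dist x.
  by rewrite sin_acos// yE sqrtr_sqr normrM normfV [ `|dist x| ]gtr0_norm.
rewrite /polar /angle -/y; case: ifPn => x2.
  rewrite cosy siny ger0_norm// /y ![dist x * _]mulrC !divfK//.
  by case: (x).
rewrite (_ : 2 * pi - _ = - acos y + pi + pi); last by ring.
rewrite !cosDpi !sinDpi !opprK cosN sinN cosy siny ltr0_norm ?ltNge// /y.
by rewrite mulNr opprK ![dist x * _]mulrC !divfK//; case: (x).
Qed.
End polar_coordinates.

Lemma cvg_expeRN (R : realType) (s : nat -> \bar R) (l : \bar R) :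
  {homo s : m n / (m <= n)%N >-> (m <= n)%E} -> s @ \oo --> l ->
  expeR (- s n) @[n --> \oo] --> expeR (- l).
Proof.
move=> snd sl; rewrite -(ereal_inf_expeRN snd sl).
apply: ereal_nonincreasing_cvgn => m n mn.
by rewrite lee_expeR leeN2; exact: snd.
Qed.

(** Truncating at 0 keeps the integrand in [0, 1] at every real [h], as [integrate_out_marks]
    requires; negative fadings have probability 0. *)
Lemma exp1_laplace_max (R : realType) (c : R) : 0 <= c ->
  (\int[exp1 R]_h (expR (- (c * Num.max h 0)))%:E = ((1 + c)^-1)%:E)%E.
Proof.
move=> c0; rewrite -exp1_laplace//.
have mexp (g : measurableTypeR R -> R) : measurable_fun setT g ->
    measurable_fun setT (fun h => (expR (- (c * g h)))%:E).
  move=> mg; apply/measurable_EFinP; apply: measurableT_comp => //.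
  by apply: measurable_funN; exact: measurable_funM.
have mpos : measurable ([set h | 0 < h] : set (measurableTypeR R)).
  rewrite (_ : [set h | 0 < h] = `]0, +oo[%classic); first exact: measurable_itv.
  by apply/seteqP; split => h /=; rewrite in_itv/= andbT.
apply: (ge0_ae_eq_integral measurableT).
- by apply: mexp; apply: measurable_maxr.
- exact: mexp.
- by move=> h _; rewrite lee_fin expR_ge0.
- by move=> h _; rewrite lee_fin expR_ge0.
exists (~` [set h | 0 < h]); split.
- exact: measurableC.
- apply: (etrans (@probability_setC _ _ _ (exp1 R) _ mpos)).
  by rewrite exp1_tail// oppr0 expR0 subee.
- move=> h /= /not_implyP[_]; apply: contra_not => h0.
  by rewrite max_l// ltW.
Qed.

Lemma cond_probE (R : realType) d (T : measurableType d) (P : probability T R)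
    (G : set T) (mG : measurable G) (A : set T) (p : R) : 0 < p -> P G = p%:E ->
  cond_prob P mG A = (P (A `&` G) * p^-1%:E)%E.
Proof.
move=> p0 PG; rewrite /cond_prob /= /mnormalize /= /mrestr setTI PG/=.
by rewrite eqe gt_eqF//= .
Qed.

(** The conditional law has density [p^-1 * \1_G] with respect to [P]. *)
Lemma ge0_integral_cond_prob (R : realType) d (T : measurableType d)
    (P : probability T R) (G : set T) (mG : measurable G) (p : R)
    (f : T -> \bar R) : 0 < p -> P G = p%:E ->
  measurable_fun setT f -> (forall w, (0 <= f w)%E) ->
  (p%:E * \int[cond_prob P mG]_w f w = \int[P]_w (f w * (\1_G w)%:E))%E.
Proof.
move=> p0 PG mf f0.
have g0 w : 0 <= p^-1 * \1_G w :> R by rewrite mulr_ge0// invr_ge0 ltW.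
have mg : measurable_fun setT (fun w => p^-1 * \1_G w).
  by apply: measurable_funM => //; exact: measurable_indic.
rewrite (eq_measure_integral (with_density P g0 mg)); last first.
  move=> A mA _; apply: (etrans (cond_probE mG A p0 PG)).
  rewrite -[RHS]/(\int[P]_(w in A) (p^-1 * \1_G w)%:E)%E.
  under [RHS]eq_integral do rewrite EFinM.
  rewrite ge0_integralZl//; last 2 first.
  - by apply/measurable_EFinP; apply: measurable_funTS; exact: measurable_indic.
  - by rewrite lee_fin invr_ge0 ltW.
  by rewrite integral_indic// setIC muleC.
rewrite ge0_integral_with_density// -ge0_integral_scale//; last first.
  by move=> w _; rewrite mule_ge0// lee_fin.
apply: eq_integral => w _; rewrite muleCA -EFinM mulrA divff ?gt_eqF//.
by rewrite mul1r.
Qed.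

Lemma measurable_expeR (R : realType) : measurable_fun setT (@expeR R).
Proof.
rewrite (_ : @expeR R = fun x => if x == -oo%E then 0%E else
    if x == +oo%E then +oo%E else (expR (fine x))%:E).
  apply: measurable_fun_ifT => //; first exact: measurable_fun_eqe.
  apply: measurable_fun_ifT => //; first exact: measurable_fun_eqe.
  by apply/measurable_EFinP; apply: measurableT_comp => //; exact: measurable_fine.
by apply/funext => -[x||].
Qed.

(** * Laplace transform of the interference on the serving event *)

Section serving.
Context (R : realType) d (T : measurableType d) (P : probability T R).
Variables (lambda : R) (c : stations R T) (ell : bool -> R -> R).
Variables (q : bool -> R * R -> R) (thr : bool -> \bar R) (tau a : R).
Hypothesis lambda0 : 0 < lambda.
Hypothesis ell_ge0 : forall v (t : R), 0 <= t -> 0 <= ell v t.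
Hypothesis ell_nonincr : forall v (t1 t2 : R), 0 <= t1 -> t1 <= t2 -> ell v t2 <= ell v t1.
Hypothesis mq : forall v, measurable_fun setT (q v).
Hypothesis q0 : forall v x, 0 <= q v x.
Variable qsum : R.
Hypothesis q_sum : forall x, q true x + q false x = qsum.
Hypothesis hP : is_marked_ppp P lambda (ot_pos c) (ot_mark c)
  (fun x D => \sum_(v : bool) (q v x)%:E * exponential_prob 1 [set h | D (v, h)])%E.
Hypothesis fading_ge0 : forall n w, 0 <= (ot_mark c n w).2.
Hypothesis tau0 : 0 < tau.
Hypothesis a0 : 0 < a.

(** One minus the mean factor of a station of type [v] at distance [t]: the factor is 0 within the
    exclusion radius, and [1 - (1 + tau b / a)^-1] is [interf_factor tau a b] beyond it. *)
Definition serving_weight v t : R :=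
  if (thr v < t%:E)%E then interf_factor tau a (ell v t) else 1.

(** The first mark lies in the full set with probability 1, and the kernel gives this event
    probability [qsum]. *)
Let q1 x : q true x + q false x = 1.
Proof.
rewrite q_sum; have := hP.2 1%N (setT : set T) (fun=> setT)
  (@measurableT _ (g_sigma_algebraType (sigma_seq (ot_pos c)))) (fun=> measurableT).
rewrite setTI (_ : [set w | _] = setT); last by apply/seteqP; split.
under eq_integral do rewrite big_ord1 big_bool/=.
have -> : exponential_prob 1 [set h : R | True] = 1%E.
  exact: (@probability_setT _ _ _ (exp1 R)).
under eq_integral do rewrite !mule1 -EFinD q_sum.
rewrite (integral_cst P measurableT).
move=> h; have {h} : (P setT = qsum%:E * P setT)%E := h.
by rewrite probability_setT mule1 => -[].
Qed.

Let ell_dist_ge0 v x : 0 <= ell v (dist x).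
Proof. by apply: ell_ge0; exact: dist_ge0. Qed.

Lemma measurable_ell_max v : measurable_fun setT (fun t : R => ell v (Num.max t 0)).
Proof.
apply: nonincreasing_measurable => // x y xy; apply: ell_nonincr.
  by rewrite le_max lexx orbT.
by rewrite ge_max le_max xy/= le_max lexx orbT.
Qed.

Lemma measurable_ell_dist v : measurable_fun setT (fun x => ell v (dist x)).
Proof.
rewrite (_ : (fun x => _) = (fun t : R => ell v (Num.max t 0)) \o @dist R).
  by apply: measurableT_comp; [exact: measurable_ell_max|exact: measurable_dist].
by apply/funext => x /=; rewrite max_l// dist_ge0.
Qed.

Let far v (x : R * R) : bool := (thr v < (dist x)%:E)%E.

Let mfar v : measurable_fun setT (far v).
Proof.
by apply: measurable_fun_lte => //; apply/measurable_EFinP; exact: measurable_dist.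
Qed.

Let rate v (x : R * R) := tau / a * ell v (dist x).

Let rate_ge0 v x : 0 <= rate v x.
Proof. by rewrite mulr_ge0// divr_ge0// ltW. Qed.

Let mrate v : measurable_fun setT (rate v).
Proof. by apply: measurable_funM => //; exact: measurable_ell_dist. Qed.

Let phi v (z : (R * R) * measurableTypeR R) : R :=
  (far v z.1)%:R * expR (- (rate v z.1 * Num.max z.2 0)).

Let mnat d' (U : measurableType d') (f : U -> bool) :
  measurable_fun setT f -> measurable_fun setT (fun x => (f x)%:R : R).
Proof.
move=> mf; have mb : measurable_fun (setT : set bool) (fun b => b%:R : R) by move=> _ Y mY.
exact: measurableT_comp mb mf.
Qed.

Let mphi v : measurable_fun setT (phi v).
Proof.
apply: measurable_funM.
  exact: (@mnat _ _ (fun z : (R * R) * measurableTypeR R => far v z.1)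
    (measurableT_comp (mfar v) measurable_fst)).
apply: measurableT_comp => //; apply: measurable_funN; apply: measurable_funM.
  exact: measurableT_comp (mrate v) measurable_fst.
by apply: measurable_maxr => //; exact: measurable_snd.
Qed.

Let phi01 v z : 0 <= phi v z <= 1.
Proof.
rewrite mulr_ge0 ?expR_ge0//= mulr_ile1 ?expR_ge0//.
  by case: (far v _).
rewrite -expR0 ler_expR oppr_le0 mulr_ge0//.
by rewrite le_max lexx orbT.
Qed.

Let barE v x : (\int[exp1 R]_h (phi v (x, h))%:E)%E =
  ((far v x)%:R * (1 + rate v x)^-1)%:E.
Proof.
rewrite /phi/=; under eq_integral do rewrite EFinM.
rewrite ge0_integralZl//.
- by rewrite exp1_laplace_max.
- apply/measurable_EFinP; apply: measurableT_comp => //; apply: measurable_funN.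
  by apply: measurable_funM => //; exact: measurable_maxr.
Qed.

Let u x := q true x * serving_weight true (dist x) +
           q false x * serving_weight false (dist x).

Let weightE v x :
  serving_weight v (dist x) = 1 - fine (\int[exp1 R]_h (phi v (x, h))%:E)%E.
Proof.
rewrite barE/= /serving_weight /far; case: ifP => _; last by rewrite mul0r subr0.
rewrite mul1r /interf_factor /rate; have := ell_dist_ge0 v x.
set b := ell v (dist x); rewrite le_eqVlt => /predU1P[<-|b0].
  by rewrite eqxx mulr0 addr0 invr1 subrr.
rewrite gt_eqF//; field.
rewrite !gt_eqF//=; rewrite ?addr_gt0 ?mulr_gt0//.
Qed.

Let interf01 v x : 0 <= serving_weight v (dist x) <= 1.
Proof.
rewrite weightE barE/=.
have i1 : 0 <= (1 + rate v x)^-1 <= 1.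
  have r1 : 1 <= 1 + rate v x by rewrite lerDl.
  by rewrite invr_ge0 (le_trans _ r1)//= invf_le1// (lt_le_trans _ r1).
by case: far; move: i1; rewrite /= ?mul1r ?mul0r; lra.
Qed.

Lemma measurable_serving_weight v : measurable_fun setT (fun x => serving_weight v (dist x)).
Proof.
under eq_fun do rewrite weightE barE /=.
apply: measurable_funB => //; apply: measurable_funM; first exact: mnat.
apply: measurableT_comp (@measurable_inv R) _.
exact: measurable_funD.
Qed.

Let u01 x : 0 <= u x <= 1.
Proof.
have q1x := q1 x.
have /andP[t0 t1] := interf01 true x; have /andP[f0 f1] := interf01 false x.
rewrite addr_ge0 ?mulr_ge0//= -q1x lerD// ler_piMr//.
Qed.

Let mu_ : measurable_fun setT u.
Proof. by apply: measurable_funD; apply: measurable_funM => //; exact: measurable_serving_weight. Qed.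

Let prodphi n w := \prod_(l < n) phi (ot_mark c l w).1 (ot_pos c l w, (ot_mark c l w).2).

Let mfarM n v : measurable_fun setT (fun w => far v (ot_pos c n w)).
Proof. by apply: measurableT_comp; [exact: mfar|exact: measurable_funPT]. Qed.

Let mtype n v : measurable [set w | (ot_mark c n w).1 = v].
Proof.
rewrite -[X in measurable X]setTI.
have m1 : measurable_fun setT (fun w => (ot_mark c n w).1).
  by apply: measurableT_comp measurable_fst _; exact: measurable_funPT.
exact: (m1 measurableT [set v]).
Qed.

Let typeE (f : bool -> T -> R) n w : f (ot_mark c n w).1 w =
  \1_[set w | (ot_mark c n w).1 = true] w * f true w +
  \1_[set w | (ot_mark c n w).1 = false] w * f false w.
Proof.
rewrite !indicE; case E : (ot_mark c n w).1.
  by rewrite mem_set// memNset ?mul1r ?mul0r ?addr0//= E.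
by rewrite [in X in _ = _ + X]mem_set// memNset ?mul1r ?mul0r ?add0r//= E.
Qed.

Let measurable_type_fun (f : bool -> T -> R) n : (forall v, measurable_fun setT (f v)) ->
  measurable_fun setT (fun w => f (ot_mark c n w).1 w).
Proof.
move=> mf; under eq_fun do rewrite typeE.
by apply: measurable_funD; apply: measurable_funM => //; exact/measurable_indic/mtype.
Qed.

Let power n w := (ot_mark c n w).2 * ell (ot_mark c n w).1 (dist (ot_pos c n w)).

Let power_ge0 n w : 0 <= power n w. Proof. exact: mulr_ge0. Qed.

Let mpower n : measurable_fun setT (power n).
Proof.
apply: measurable_funM.
  by apply: measurableT_comp measurable_snd _; exact: measurable_funPT.
apply: (measurable_type_fun (f := fun v w => ell v (dist (ot_pos c n w)))) => v.
exact: measurableT_comp (measurable_ell_dist v) (@measurable_funPT _ _ _ _ (ot_pos c n)).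
Qed.

Lemma interference_ge0 w : (0 <= interference ell c w)%E.
Proof. by apply: nneseries_ge0 => n _ _; rewrite lee_fin; exact: power_ge0. Qed.

Lemma measurable_interference : measurable_fun setT (interference ell c).
Proof.
apply: ge0_emeasurable_sum => [n w _ _|n _]; first by rewrite lee_fin; exact: power_ge0.
exact/measurable_EFinP/mpower.
Qed.

Lemma measurable_others_far : measurable [set w | forall n,
  (thr (ot_mark c n w).1 < (dist (ot_pos c n w))%:E)%E].
Proof.
rewrite (_ : [set w | _] = \bigcap_n [set w |
    (far (ot_mark c n w).1 (ot_pos c n w))%:R = 1 :> R]).
  apply: bigcap_measurableType => n _; rewrite -[X in measurable X]setTI.
  have mf : measurable_fun setT (fun w => (far (ot_mark c n w).1 (ot_pos c n w))%:R : R).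
    apply: (measurable_type_fun (f := fun v w => (far v (ot_pos c n w))%:R)) => v.
    by apply: mnat; exact: mfarM.
  exact: (mf measurableT [set 1]).
apply/seteqP; split => w /= h n; first by move=> _; rewrite /= /far h.
by have := h n I; rewrite /= /far; case: (_ < _)%E => // /eqP; rewrite eq_sym oner_eq0.
Qed.

(** The expectations of the products over the first [n] stations have two limits: integrating out
    the marks and [ppp_pgfl] give the right side, dominated convergence gives the left side. *)
Lemma serving_laplace :
  (\int[P]_w ((\1_[set w | forall n,
       (thr (ot_mark c n w).1 < (dist (ot_pos c n w))%:E)%E] w)%:E *
     expeR (- ((tau / a)%:E * interference ell c w))) =
   expeR (- (lambda%:E * \int[(@lebesgue_measure R \x @lebesgue_measure R)%E]_x
     (q true x * serving_weight true (dist x) +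
      q false x * serving_weight false (dist x))%:E)))%E.
Proof.
have mpos n : measurable_fun setT (ot_pos c n) by exact: measurable_funPT.
have mmark n : measurable_fun setT (ot_mark c n) by exact: measurable_funPT.
have lim1 : (\int[P]_w (prodphi n w)%:E)%E @[n --> \oo] -->
    expeR (- (lambda%:E * \int[(@lebesgue_measure R \x @lebesgue_measure R)%E]_x (u x)%:E)).
  have E n : (\int[P]_w (prodphi n w)%:E =
      \int[P]_w (\prod_(l < n) (1 - u (ot_pos c l w)))%:E)%E.
    rewrite (@integrate_out_marks R d T P _ (R * R)%type _ (measurableTypeR R) (exp1 R) q
      (ot_pos c) (ot_mark c) mpos mmark mq q0 hP.2 phi mphi phi01 n).
    apply: eq_integral => w _; congr EFin; apply: eq_bigr => l _.
    by rewrite /u !weightE -{1}(q1 (ot_pos c l w)); ring.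
  by under eq_fun do rewrite E; exact: ppp_pgfl lambda0 mpos hP.1 _ mu_ u01.
pose target w := ((\1_[set w | forall n,
    (thr (ot_mark c n w).1 < (dist (ot_pos c n w))%:E)%E] w)%:E *
  expeR (- ((tau / a)%:E * interference ell c w)))%E.
have lim2 : (\int[P]_w (prodphi n w)%:E)%E @[n --> \oo] --> (\int[P]_w target w)%E.
  have [] // := @dominated_convergence _ _ _ P setT measurableT
    (fun n w => (prodphi n w)%:E) target (cst 1%E).
  - move=> n; apply/measurable_EFinP; apply: measurable_prod => l _.
    apply: (measurable_type_fun (f := fun v w => phi v (ot_pos c l w, (ot_mark c l w).2))) => v.
    apply: measurableT_comp (mphi v) _; apply: measurable_fun_pair => //.
    exact: measurableT_comp measurable_snd (mmark l).
  - apply: emeasurable_funM.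
      by apply/measurable_EFinP; apply: measurable_indic; exact: measurable_others_far.
    apply: measurableT_comp; first exact: measurable_expeR.
    by apply: measurableT_comp => //; apply: measurable_funeM; exact: measurable_interference.
  - apply: aeW => w _; rewrite /target.
    have prodE n : prodphi n w = (\prod_(l < n) (far (ot_mark c l w).1 (ot_pos c l w))%:R) *
        expR (- \sum_(0 <= l < n) tau / a * power l w).
      rewrite big_mkord -sumrN expR_sum -big_split; apply: eq_bigr => l _.
      by rewrite /phi/= /rate /power max_l//; congr (_ * expR (- _)); ring.
    (* If station [k] is too close, all products of more than [k] factors are 0. Otherwise the
       exponent is a partial sum of the interference; an infinite sum is covered by
       [expeR (- +oo) = 0]. *)
    have [h|/existsNP[k h]] := pselect (forall n,
        (thr (ot_mark c n w).1 < (dist (ot_pos c n w))%:E)%E); last first.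
      rewrite indicE memNset; last by move=> /(_ k).
      rewrite mul0e; apply: cvg_near_cst; near=> n; congr EFin; rewrite prodE.
      have kn : (k < n)%N by near: n; exact: nbhs_infty_gt.
      by rewrite (bigD1 (Ordinal kn))//= /far (negbTE (introN idP h)) mul0r mul0r.
    rewrite indicE mem_set// mul1e.
    pose s n : \bar R := ((tau / a)%:E * \sum_(0 <= l < n) (power l w)%:E)%E.
    rewrite (_ : (fun n => _) = (fun n => expeR (- s n))).
      apply: cvg_expeRN.
        move=> m n mn; apply: lee_wpmul2l; first by rewrite lee_fin divr_ge0// ltW.
        by apply: lee_sum_nneg_natr => // l _ _; rewrite lee_fin.
      by apply: cvgeZl => //; apply: is_cvg_nneseries => n _ _; rewrite lee_fin.
    apply/funext => n; rewrite prodE big1 ?mul1r; last by move=> l _; rewrite /far h.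
    by rewrite /s sumEFin -EFinM -EFinN /= mulr_sumr.
  - exact: finite_measure_integrable_cst.
  - apply: aeW => w n _; rewrite gee0_abs lee_fin.
      by apply: prodr_ile1 => l _; exact: phi01.
    by apply: prodr_ge0 => l _; have /andP[] := phi01 (ot_mark c l w).1 (ot_pos c l w, (ot_mark c l w).2).
exact: (cvg_unique _ lim2 lim1).
Unshelve. all: by end_near. Qed.

End serving.

(** * Splitting the exponent at the exclusion radius *)

Section polar_split.
Context (R : realType).
Local Notation mR := (measurableTypeR R).
Local Notation leb := (@lebesgue_measure R).
Variables (q : R * R -> R) (thr : \bar R) (i : R -> R).
Hypothesis mq : measurable_fun setT q.
Hypothesis q0 : forall x, 0 <= q x.
Hypothesis thr0 : (0 <= thr)%E.
Hypothesis mi : measurable_fun setT (fun t : R => i (Num.max t 0)).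
Hypothesis i0 : forall t, 0 <= t -> 0 <= i t.
Hypothesis mw : measurable_fun setT (fun x => if (thr < (dist x)%:E)%E then i (dist x) else 1).

Let D : set R := `[0, (2 * pi)]%classic.
Let near (t : R) : R := ((0 <= t) && (t%:E <= thr)%E)%:R.
Let far (t : R) : R := ((0 <= t) && (thr < t%:E)%E)%:R.
(** [i] and [t] are nonnegative for [t >= 0]; the truncation extends this to the line, where [near]
    and [far] discard negative [t]. *)
Let ip (t : R) := i (Num.max t 0).
Let tp (t : R) := Num.max t 0.

Let mbool (f : R -> bool) : measurable_fun setT f -> measurable_fun setT (fun x => (f x)%:R : R).
Proof.
move=> mf; have mb : measurable_fun (setT : set bool) (fun b => b%:R : R) by move=> _ Y mY.
exact: measurableT_comp mb mf.
Qed.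

Let mnear : measurable_fun setT near.
Proof.
by apply: mbool; apply: measurable_and; [exact: measurable_fun_ler|exact: measurable_fun_lee].
Qed.

Let mfar : measurable_fun setT far.
Proof.
by apply: mbool; apply: measurable_and; [exact: measurable_fun_ler|exact: measurable_fun_lte].
Qed.

Let mtp : measurable_fun setT tp. Proof. exact: measurable_maxr. Qed.

Let tp0 t : 0 <= tp t. Proof. by rewrite le_max lexx orbT. Qed.

Let ip0 t : 0 <= ip t. Proof. by apply: i0; exact: tp0. Qed.

Let qp (z : R * R) := q (polar z.2 z.1).

Let near0 t : 0 <= near t. Proof. exact: ler0n. Qed.
Let far0 t : 0 <= far t. Proof. exact: ler0n. Qed.
Let qp0 z : 0 <= qp z. Proof. exact: q0. Qed.

Let mqp : measurable_fun setT qp.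
Proof. exact: measurableT_comp mq (@measurable_polar R). Qed.

Let A (z : R * R) : \bar R := (near z.2 * qp z * tp z.2)%:E.
Let B (z : R * R) : \bar R := (far z.2 * qp z * ip z.2 * tp z.2)%:E.

Let m2 (f : R -> R) : measurable_fun setT f ->
  measurable_fun (setT : set (R * R)) (fun z => f z.2).
Proof. by move=> mf; exact: measurableT_comp mf measurable_snd. Qed.

Let mA : measurable_fun setT A.
Proof.
apply/measurable_EFinP; apply: measurable_funM; last exact: (m2 mtp).
by apply: measurable_funM => //; exact: (m2 mnear).
Qed.

Let mB : measurable_fun setT B.
Proof.
apply/measurable_EFinP; apply: measurable_funM; last exact: (m2 mtp).
apply: measurable_funM; last exact: (m2 mi).
by apply: measurable_funM => //; exact: (m2 mfar).
Qed.

Let A0 z : (0 <= A z)%E.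
Proof. by rewrite lee_fin !mulr_ge0. Qed.

Let B0 z : (0 <= B z)%E.
Proof. by rewrite lee_fin !mulr_ge0. Qed.

Let mD : measurable (D : set mR). Proof. exact: measurable_itv. Qed.

(** The near part keeps the angular integral outside, as in [void_exponent]; in the far part the
    integrals are exchanged so that [i t] leaves the angular one, as in [kappa]. *)
Lemma integral_polar_split :
  (\int[(leb \x leb)%E]_x (q x * (if (thr < (dist x)%:E)%E then i (dist x) else 1))%:E =
   \int[leb]_(theta in `[0%R, (2 * pi)%R])
     \int[leb]_(t in [set t | (0 <= t)%R /\ (t%:E <= thr)%E]) (q (polar t theta) * t)%:E +
   \int[leb]_(t in [set t | (thr <= t%:E)%E])
     ((i t)%:E * (\int[leb]_(theta in `[0%R, (2 * pi)%R]) (q (polar t theta))%:E) * t%:E))%E.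
Proof.
rewrite integral_polar; last 2 first.
- move=> z; rewrite lee_fin mulr_ge0//; case: ifP => // _; exact/i0/dist_ge0.
- by apply/measurable_EFinP; exact: measurable_funM.
transitivity (\int[leb]_(theta in D) (\int[leb]_t A (theta, t) + \int[leb]_t B (theta, t)))%E.
  apply: eq_integral => theta _.
  rewrite -ge0_integralD//; last 2 first.
  - exact: measurableT_comp mA (measurable_pair1 theta).
  - exact: measurableT_comp mB (measurable_pair1 theta).
  rewrite [LHS]integral_mkcond; apply: eq_integral => t _.
  rewrite patchE -EFinD /A /B /near /far /ip /tp /qp/=.
  have [t0|t0] := leP 0 t; last first.
    by rewrite memNset ?mul0r ?addr0//= in_itv/= andbT; apply/negP; rewrite -ltNge.
  rewrite mem_set/= ?in_itv/= ?t0// dist_polar// -EFinM; congr EFin.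
  by rewrite ltNge; case: (_ <= _)%E; rewrite /= ?max_l//; ring.
rewrite ge0_integralD//; last 4 first.
- by move=> z _; exact: integral_ge0.
- by apply: measurable_funTS; exact: (measurable_plane_integral1 mA A0).
- by move=> z _; exact: integral_ge0.
- by apply: measurable_funTS; exact: (measurable_plane_integral1 mB B0).
congr (_ + _)%E.
  apply: eq_integral => theta _; rewrite [RHS]integral_mkcond.
  apply: eq_integral => t _; rewrite patchE /A /near /tp /qp/=.
  have [/andP[t0 tthr]|h] := boolP ((0 <= t) && (t%:E <= thr)%E).
    by rewrite mem_set//= mul1r max_l.
  by rewrite memNset ?mul0r//= => /andP; exact/negP.
pose C (z : R * R) : \bar R := ((\1_D z.1)%:E * B z)%E.
have C0 z : (0 <= C z)%E by rewrite mule_ge0.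
have mC : measurable_fun setT C.
  apply: emeasurable_funM => //; apply/measurable_EFinP.
  by apply: measurableT_comp measurable_fst; exact: measurable_indic.
transitivity (\int[leb]_theta \int[leb]_t C (theta, t))%E.
  rewrite integral_mkcond; apply: eq_integral => theta _; rewrite patchE /C/= indicE.
  case: ifP => _; first by apply: eq_integral => t _; rewrite mul1e.
  by rewrite integral0_eq// => t _; rewrite mul0e.
rewrite (plane_tonelli mC C0) [RHS]integral_mkcond.
pose E (z : R * R) : \bar R := ((\1_D z.1)%:E * (qp z)%:E)%E.
have E0 z : (0 <= E z)%E by rewrite mule_ge0 ?lee_fin//; exact: q0.
have mE : measurable_fun setT E.
  apply: emeasurable_funM; apply/measurable_EFinP; last exact: mqp.
  by apply: measurableT_comp measurable_fst; exact: measurable_indic.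
pose h t := (\int[leb]_theta E (theta, t))%E.
have h0 t : (0 <= h t)%E by exact: integral_ge0.
have mh : measurable_fun setT h by exact: (measurable_plane_integral2 mE E0).
have hE t : (\int[leb]_(theta in D) (q (polar t theta))%:E = h t)%E.
  rewrite integral_mkcond; apply: eq_integral => theta _; rewrite patchE /E/= indicE.
  by case: ifP => _; rewrite ?mul1e ?mul0e.
transitivity (\int[leb]_t ((far t * ip t * tp t)%:E * h t))%E.
  apply: eq_integral => t _; rewrite -ge0_integralZl//.
  - apply: eq_integral => theta _; rewrite /C /B /E -!EFinM/=.
    by congr EFin; ring.
  - exact: measurableT_comp mE (measurable_pair2 t).
  - by rewrite lee_fin !mulr_ge0.
have mclosed : measurable_fun setT (fun t : R => (thr <= t%:E)%E%:R : R).
  by apply: mbool; exact: measurable_fun_lee.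
transitivity (\int[leb]_t (((thr <= t%:E)%E%:R * ip t * tp t)%:E * h t))%E; last first.
  apply: eq_integral => t _; rewrite patchE hE.
  have [h1|h1] := boolP (thr <= t%:E)%E; last first.
    by rewrite memNset ?mul0r ?mul0e//; exact/negP.
  have t0 : 0 <= t by rewrite -lee_fin (le_trans thr0).
  by rewrite mem_set// mul1r /ip /tp max_l// EFinM -!muleA [(t%:E * _)%E]muleC.
apply: (ge0_ae_eq_integral measurableT).
- apply: emeasurable_funM => //; apply/measurable_EFinP.
  by apply: measurable_funM => //; exact: measurable_funM.
- apply: emeasurable_funM => //; apply/measurable_EFinP.
  by apply: measurable_funM => //; exact: measurable_funM.
- by move=> t _; rewrite mule_ge0// lee_fin !mulr_ge0.
- by move=> t _; rewrite mule_ge0// lee_fin !mulr_ge0.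
(* The strict inequality of the serving event and the large one of [kappa] differ at most at
   [t = thr]; they agree at every [t] when [thr] is infinite. *)
exists [set fine thr]; split.
- exact: measurable_set1.
- exact: lebesgue_measure_set1.
move=> t /= /not_implyP[_]; apply: contra_notP => tthr.
rewrite /far; congr ((_%:R * _ * _)%:E * _)%E.
have [h1|h1|h1] := ltgtP thr t%:E.
- by rewrite andbT -lee_fin (le_trans thr0)// ltW.
- by rewrite andbF.
- by exfalso; apply: tthr; rewrite h1.
Qed.
End polar_split.

(** * Integrating out the fading of the given station *)

Section sinr_event.
Context (R : realType) d (T : measurableType d) (c : stations R T).
Variables (ell : bool -> R -> R) (sigma2 tau r : R) (s : bool).
Hypothesis ell_ge0 : forall v (t : R), 0 <= t -> 0 <= ell v t.
Hypothesis ell_nonincr : forall v (t1 t2 : R), 0 <= t1 -> t1 <= t2 -> ell v t2 <= ell v t1.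
Hypothesis sigma0 : 0 < sigma2.
Hypothesis fading_ge0 : forall n w, 0 <= (ot_mark c n w).2.
Hypothesis tau0 : 0 < tau.

Let I_ge0 w : (0 <= interference ell c w)%E. Proof. exact: interference_ge0. Qed.

Lemma sinr_zero w : ell s r = 0 -> sinr ell sigma2 c s r w = 0.
Proof. by move=> ell0; rewrite /sinr ell0 mulr0 mul0e. Qed.

(** If the interference is infinite both sides are false: the SINR is 0 and the threshold on the
    fading is [+oo]. *)
Lemma sinr_gt w : 0 < ell s r ->
  (tau < sinr ell sigma2 c s r w) =
  ((tau / ell s r)%:E * (sigma2%:E + interference ell c w) < (bs_fading c w)%:E)%E.
Proof.
move=> a0; rewrite /sinr; have := I_ge0 w.
case: (interference ell c w) => [i i0| _ |//]; last first.
  rewrite addey// invey mule0/= ltNge (ltW tau0)/= gt0_muley ?lte_fin ?divr_gt0//.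
have si : 0 < sigma2 + i by rewrite ltr_pwDl.
rewrite -EFinD inver gt_eqF// -!EFinM/= lte_fin.
by rewrite ltr_pdivlMr// mulrAC ltr_pdivrMr.
Qed.

Definition nonfading_events : set (set T) :=
  <<s preimage_set_system setT (bs_type c) measurable `|`
      sigma_seq (ot_pos c) `|` sigma_seq (ot_mark c) >>.

(** The sample space with the sigma-algebra from which the given fading is independent, so that
    belonging to [nonfading_events] becomes plain measurability. *)
Definition nonfading := g_sigma_algebraType
  (preimage_set_system setT (bs_type c) measurable `|`
   sigma_seq (ot_pos c) `|` sigma_seq (ot_mark c)).

Let mfun_of d' (U : measurableType d') (f : nonfading -> U) :
  measurable_fun setT f -> {g : {mfun nonfading >-> U} | g = f :> (nonfading -> U)}.
Proof. by move=> mf; exists (mfun_Sub (mem_set mf)). Qed.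

(* The interference and the serving event do not involve the fading of the given
   station: they are those of stations over the smaller sigma-algebra, where this
   fading is replaced by a constant. *)
Let nonfading_stations : {c' : stations R nonfading |
  (forall n, ot_pos c' n = ot_pos c n :> (T -> _)) /\
  (forall n, ot_mark c' n = ot_mark c n :> (T -> _))}.
Proof.
have mX n : measurable_fun (setT : set nonfading) (ot_pos c n).
  move=> _ B mB; apply: sub_sigma_algebra; left; right; exists n => //.
  by exists B.
have mM n : measurable_fun (setT : set nonfading) (ot_mark c n).
  move=> _ B mB; apply: sub_sigma_algebra; right; exists n => //.
  by exists B.
exists (Stations (cst LoS : {mfun nonfading >-> bool}) (cst (0 : R) : {mfun nonfading >-> R})
  (fun n => projT1 (mfun_of (mX n))) (fun n => projT1 (mfun_of (mM n)))); split => n /=.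
  exact: (projT2 (mfun_of (mX n))).
exact: (projT2 (mfun_of (mM n))).
Qed.

Let minterf : measurable_fun (setT : set nonfading) (interference ell c).
Proof.
have [c' [posE markE]] := nonfading_stations.
rewrite (_ : interference ell c = interference ell c').
  by apply: measurable_interference => // n w; rewrite markE.
apply/funext => w; rewrite /interference; apply: eq_eseriesr => n _.
by rewrite posE markE.
Qed.

Let mserving : measurable (serving_event ell c s r : set nonfading).
Proof.
apply: measurableI.
  apply: sub_sigma_algebra; left; left; exists [set s] => //.
  by rewrite setTI.
have [c' [posE markE]] := nonfading_stations.
have := measurable_others_far c' (fun v => excl ell v s r).
congr (measurable _); apply/seteqP; split => w /= h n; have := h n;
  by rewrite posE markE.
Qed.

(** Infinite interference stands for not serving, so that the whole event depends on [X] and the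
    given fading alone. *)
Let X (w : T) : \bar R :=
  if w \in serving_event ell c s r then interference ell c w else +oo%E.

Let mX : measurable_fun (setT : set nonfading) X.
Proof.
apply: measurable_fun_ifT => //.
by apply: (measurable_fun_bool true); rewrite setTI preimage_mem_true.
Qed.

Let nonfading_sub A : measurable (A : set nonfading) -> measurable (A : set T).
Proof.
apply: smallest_sub; first exact: sigma_algebra_measurable.
move=> B [[[D mD <-]|[n _ [D mD <-]]]|[n _ [D mD <-]]].
- exact: (measurable_funPT (bs_type c)).
- exact: (measurable_funPT (ot_pos c n)).
- exact: (measurable_funPT (ot_mark c n)).
Qed.

Let mXT : measurable_fun setT X.
Proof. by move=> _ B mB; apply: nonfading_sub; exact: mX. Qed.

Variable P : probability T R.
Hypothesis independent_fading : forall (D : set R) (G : set T), measurable D ->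
  nonfading_events G -> P ((bs_fading c @^-1` D) `&` G) = (exponential_prob 1 D * P G)%E.

(** The event says that the fading exceeds a threshold which is a function of the independent
    variable [X]. Integrating the fading first leaves the exponential of minus the threshold, which
    is 0 where [X] is infinite. *)
Lemma sinr_laplace : 0 < ell s r ->
  P (serving_event ell c s r `&` [set w | tau < sinr ell sigma2 c s r w]) =
  ((expR (- (tau * sigma2 / ell s r)))%:E *
   \int[P]_w ((\1_(serving_event ell c s r) w)%:E *
     expeR (- ((tau / ell s r)%:E * interference ell c w))))%E.
Proof.
move=> a0; set a := ell s r in a0 *.
have ta0 : 0 < tau / a by rewrite divr_gt0.
pose H := bs_fading c : T -> measurableTypeR R.
have mH : measurable_fun setT H by exact: (measurable_funPT (bs_fading c)).
pose E := [set z : \bar R * measurableTypeR R |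
  ((tau / a)%:E * (sigma2%:E + z.1) < z.2%:E)%E].
have mE : measurable E.
  rewrite -[X in measurable X]setTI; apply: measurable_lte => //.
    apply: measurable_funeM; apply: emeasurable_funD => //.
  apply/measurable_EFinP; exact: measurable_snd.
have X0 w : (0 <= X w)%E by rewrite /X; case: ifP.
have eventE : serving_event ell c s r `&` [set w | tau < sinr ell sigma2 c s r w] =
    [set w | E (X w, H w)].
  apply/seteqP; split => w /=.
    by move=> [sw]; rewrite sinr_gt// /E /X/= mem_set.
  rewrite /E /X/=; case: ifPn => [/set_mem sw h|_].
    by split => //; rewrite sinr_gt.
  by rewrite addey// gt0_muley ?lte_fin.
have mXH : measurable_fun setT (fun w => (X w, H w)) by exact: measurable_fun_pair.
have int1 A : measurable A -> (\int[P]_(w in A) (1%R)%:E = P A)%E.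
  by move=> mA; apply: (etrans (integral_cst P mA 1%E)); rewrite mul1e.
have rect B D : measurable B -> measurable D ->
    (\int[P]_(w in X @^-1` B `&` H @^-1` D) (1%R)%:E =
     (\int[P]_(w in X @^-1` B) (1%R)%:E) * exp1 R D)%E.
  move=> mB mD.
  have mXB : measurable (X @^-1` B : set nonfading).
    by rewrite -[X in measurable X]setTI; exact: mX.
  rewrite !int1; last 2 first.
  - exact: nonfading_sub.
  - apply: measurableI; first exact: nonfading_sub.
    by rewrite -[X in measurable X]setTI; exact: mH.
  rewrite setIC muleC; exact: independent_fading.
transitivity (\int[P]_w ((\1_E (X w, H w))%:E * (1%R)%:E))%E.
  rewrite eventE -[X in P X]setIT -integral_indic//; last first.
    by rewrite -[X in measurable X]setTI; exact: (mXH measurableT).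
  by apply: eq_integral => w _; rewrite mule1.
have := @ge0_integral_independent _ _ _ _ _ _ R P (exp1 R) X H (cst 1) (cst 1)
  (fun z => (\1_E z)%:E) mXT mH _ _ _ _ _ rect _ _.
move=> -> //; last 2 first.
- by rewrite int1// (le_lt_trans (probability_le1 _ _)) ?ltry.
- by apply/measurable_EFinP; exact: measurable_indic.
rewrite -ge0_integralZl//; last 2 first.
- apply: emeasurable_funM.
    by apply/measurable_EFinP; apply: measurable_indic; exact: nonfading_sub.
  apply: measurableT_comp; first exact: measurable_expeR.
  apply: measurableT_comp => //; apply: measurable_funeM; exact: measurable_interference.
- by move=> w _; rewrite mule_ge0// ?lee_fin// expeR_ge0.
apply: eq_integral => w _; rewrite mule1.
transitivity (expeR (- ((tau / a)%:E * (sigma2%:E + X w)))).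
  transitivity (exp1 R [set h | E (X w, h)]).
    rewrite -[X in _ = exp1 R X]setIT -integral_indic//.
    rewrite -[X in measurable X]setTI.
    exact: (@measurable_pair1 _ _ (\bar R) (measurableTypeR R) (X w) measurableT).
  rewrite /E/=; have := X0 w; case: (X w) => [x x0| _ |//].
    rewrite -EFinD -EFinM; rewrite (_ : [set h | _] = [set h | tau / a * (sigma2 + x) < h]).
      rewrite exp1_tail// mulr_ge0 ?(ltW ta0)// addr_ge0// ltW//.
    by apply/seteqP; split => h /=; rewrite lte_fin.
  rewrite addey// gt0_muley ?lte_fin//= (_ : [set h | _] = set0) ?measure0//.
  by apply/seteqP; split.
rewrite ge0_muleDr ?lee_fin ?(ltW sigma0)// -EFinM.
rewrite oppeD// expeRD/= mulrAC; congr (_ * _)%E.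
rewrite /X indicE; case: ifP => _; first by rewrite mul1e.
by rewrite mul0e gt0_muley ?lte_fin.
Qed.

End sinr_event.

(** * Coverage at a fixed distance *)

Section coverage_given_distance.
Context (R : realType) (lambda sigma2 : R) (ell : bool -> R -> R).
Hypothesis lambda0 : 0 < lambda.
Hypothesis sigma0 : 0 < sigma2.
Hypothesis ell_ge0 : forall v (t : R), 0 <= t -> 0 <= ell v t.
Hypothesis ell_nonincr : forall v (t1 t2 : R), 0 <= t1 -> t1 <= t2 -> ell v t2 <= ell v t1.
Context (db : measure_display) (Tb : measurableType db) (Pb : probability Tb R).
Context (b : blockages R Tb) (p : bool -> R -> R).
Context (d : measure_display) (T : measurableType d) (c : stations R T).
Variable Q : R -> probability T R.
Hypothesis hQ : first_order_model lambda p (joint_prob Pb b) c Q.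

Lemma excl_ge0 v s r : 0 <= r -> (0 <= excl ell v s r)%E.
Proof.
move=> r0; rewrite /excl; case: ifP => _; first by rewrite lee_fin.
by apply: le_ereal_inf_tmp => _ [y /= [y0 _] <-]; rewrite lee_fin.
Qed.

Lemma interf_factor_ge0 (tau a x : R) : 0 < tau -> 0 <= a -> 0 <= x ->
  0 <= interf_factor tau a x.
Proof.
move=> tau0 a0 x0; rewrite /interf_factor; case: ifP => // _.
by rewrite invr_ge0 addr_ge0// mulr_ge0 ?invr_ge0 ?(ltW tau0)// divr_ge0.
Qed.

Lemma measurable_interf_factor (tau a : R) : measurable_fun setT (interf_factor tau a).
Proof.
apply: measurable_fun_ifT => //; first exact: measurable_fun_eqr.
apply: measurableT_comp (@measurable_inv R) _; apply: measurable_funD => //.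
by apply: measurable_funM => //; apply: measurable_funM => //; exact: measurable_inv.
Qed.

Section fixed_distance.
Variables (s : bool) (r tau : R).
Hypothesis r0 : 0 < r.
Hypothesis tau0 : 0 < tau.
Hypothesis p0 : 0 < p s r.

(** Written at the point [x] rather than through [dist x] and [angle x], so that measurability comes
    from the link events. *)
Let q v (x : R * R) : R :=
  fine (Pb (link_event b s (polar r 0) `&` link_event b v x)) / p s r.

Let mq v : measurable_fun setT (q v).
Proof. by apply: measurable_funM => //; exact: measurable_link_joint. Qed.

Let q0 v x : 0 <= q v x.
Proof. by rewrite divr_ge0 ?(ltW p0)// fine_ge0. Qed.

(** The two types of the second link partition the sample space, so the sum does not depend on [x],
    which is what [serving_laplace] asks. *)
Let q_sum x : q true x + q false x = fine (Pb (link_event b s (polar r 0))) / p s r.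
Proof.
have mE v y := measurable_link_event b v y.
rewrite /q -mulrDl -fineD; last 2 first.
- by apply: fin_num_measure; exact: measurableI.
- by apply: fin_num_measure; exact: measurableI.
rewrite -measureU; last 3 first.
- exact: measurableI.
- exact: measurableI.
- by apply/seteqP; split => // w [[_ L] [_ N]]; exact: N.
congr (fine (Pb _) / _); rewrite -setIUr.
rewrite (_ : link_event b true x `|` link_event b false x = setT) ?setIT//.
by rewrite -[link_event b false x]/(~` link_event b true x) setUv.
Qed.

Let P := cond_prob (Q r) (measurable_type_event c s).

Let hP : is_marked_ppp P lambda (ot_pos c) (ot_mark c)
  (fun x D => \sum_(v : bool) (q v x)%:E * exponential_prob 1 [set h | D (v, h)])%E.
Proof.
have -> : (fun (x : R * R) (D : set (bool * R)) => \sum_(v : bool) (q v x)%:E *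
    exponential_prob 1 [set h | D (v, h)])%E = station_kernel p (joint_prob Pb b) s r.
  apply/funext => x; apply/funext => D; rewrite /station_kernel.
  by apply: eq_bigr => v _; rewrite /joint_prob polar_dist_angle.
exact: (fom_others hQ).
Qed.

Let thr v := excl ell v s r.

Let interf v := (\int[@lebesgue_measure R]_(t in [set t | (thr v <= t%:E)%E])
    ((lambda * interf_factor tau (ell s r) (ell v t))%:E *
     (\int[@lebesgue_measure R]_(theta in `[0%R, (2 * pi)%R])
        (joint_prob Pb b s v r t theta / p s r)%:E) * t%:E))%E.

Let void v := void_exponent lambda ell p (joint_prob Pb b) v s r.

Let void_ge0 v : (0 <= void v)%E.
Proof.
rewrite mule_ge0 ?lee_fin ?(ltW lambda0)//; apply: integral_ge0 => theta _.
apply: integral_ge0 => t [t0 _]; rewrite lee_fin mulr_ge0//.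
exact: (q0 v (polar t theta)).
Qed.

Let angular_ge0 v t : (0 <= \int[@lebesgue_measure R]_(theta in `[0%R, (2 * pi)%R])
  (joint_prob Pb b s v r t theta / p s r)%:E)%E.
Proof. by apply: integral_ge0 => theta _; rewrite lee_fin; exact: (q0 v (polar t theta)). Qed.

Let thr_ge0 v : (0 <= thr v)%E. Proof. by apply: excl_ge0; exact: ltW. Qed.

Let ell_r_ge0 : 0 <= ell s r. Proof. by apply: ell_ge0; exact: ltW. Qed.

Let integrand_ge0 v t : (thr v <= t%:E)%E ->
  (0 <= (interf_factor tau (ell s r) (ell v t))%:E *
    (\int[@lebesgue_measure R]_(theta in `[0%R, (2 * pi)%R])
        (joint_prob Pb b s v r t theta / p s r)%:E) * t%:E)%E.
Proof.
move=> tthr; have t0 : 0 <= t by rewrite -lee_fin (le_trans (thr_ge0 v)).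
rewrite mule_ge0// mule_ge0// lee_fin interf_factor_ge0//.
exact: ell_ge0.
Qed.

Let interfE v : (interf v = lambda%:E *
  \int[@lebesgue_measure R]_(t in [set t | (thr v <= t%:E)%E])
    ((interf_factor tau (ell s r) (ell v t))%:E *
     (\int[@lebesgue_measure R]_(theta in `[0%R, (2 * pi)%R])
        (joint_prob Pb b s v r t theta / p s r)%:E) * t%:E))%E.
Proof.
rewrite -ge0_integral_scale//; last by move=> t; exact: integrand_ge0.
by apply: eq_integral => t _; rewrite EFinM !muleA.
Qed.

Let interf_ge0 v : (0 <= interf v)%E.
Proof.
rewrite interfE mule_ge0 ?lee_fin ?(ltW lambda0)//.
by apply: integral_ge0 => t; exact: integrand_ge0.
Qed.

Let exponent v : 0 < ell s r ->
  (lambda%:E * \int[(@lebesgue_measure R \x @lebesgue_measure R)%E]_x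
     (q v x * serving_weight ell thr tau (ell s r) v (dist x))%:E = void v + interf v)%E.
Proof.
move=> a0; rewrite /serving_weight.
rewrite (@integral_polar_split _ (q v) (thr v)
  (fun t => interf_factor tau (ell s r) (ell v t)))//; last 3 first.
- apply: measurableT_comp; first exact: measurable_interf_factor.
  exact: measurable_ell_max.
- by move=> t t0; rewrite interf_factor_ge0//; exact: ell_ge0.
- exact: (measurable_serving_weight thr ell_ge0 ell_nonincr tau0 a0 v).
rewrite ge0_muleDr; last 2 first.
- apply: integral_ge0 => theta _; apply: integral_ge0 => t [t0 _].
  by rewrite lee_fin mulr_ge0.
- by apply: integral_ge0 => t; exact: integrand_ge0.
by rewrite interfE.
Qed.

Lemma coverage_given_distance :
  (Q r (serving_event ell c s r `&` [set w | (tau < sinr ell sigma2 c s r w)%R]) =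
   (noise_factor sigma2 tau (ell s r))%:E *
   (kappa lambda ell p (joint_prob Pb b) LoS s r tau *
    kappa lambda ell p (joint_prob Pb b) NLoS s r tau *
    serving_density lambda ell p (joint_prob Pb b) s r))%E.
Proof.
have fad0 := fom_fadings_ge0 hQ.
(* Without received signal the SINR and the noise factor are 0, and both sides vanish. *)
have := ell_r_ge0; rewrite le_eqVlt => /predU1P[a0|a0].
  rewrite -a0 /noise_factor eqxx mul0e.
  rewrite (_ : _ `&` _ = set0) ?measure0//; apply/seteqP; split => // w [_ /=].
  by rewrite sinr_zero// ltNge (ltW tau0).
rewrite (@sinr_laplace _ _ _ c ell sigma2 tau r s ell_ge0 ell_nonincr sigma0 fad0 tau0
  (Q r))//; last by move=> D G mD sG; exact: (fom_fading hQ).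
rewrite /noise_factor gt_eqF//; congr (_ * _)%E.
have mI := measurable_interference ell_ge0 ell_nonincr fad0.
have mfar : measurable [set w | forall n,
    (thr (ot_mark c n w).1 < (dist (ot_pos c n w))%:E)%E].
  exact: measurable_others_far.
pose f (w : T) := ((\1_[set w | forall n,
    (thr (ot_mark c n w).1 < (dist (ot_pos c n w))%:E)%E] w)%:E *
    expeR (- ((tau / ell s r)%R%:E * interference ell c w)))%E.
(* The serving event is split into the type of the given station and the distances of the others;
   restricting to the type gives the conditional law, under which the others form a marked Poisson
   process. *)
transitivity (\int[Q r]_w (f w * (\1_(type_event c s) w)%:E))%E.
  apply: eq_integral => w _; rewrite /f muleAC -EFinM; congr (_%:E * _)%E.
  by rewrite /serving_event indicI mulrC.
have Qp : Q r (type_event c s) = (p s r)%:E by exact: (fom_type hQ).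
rewrite -(ge0_integral_cond_prob (measurable_type_event c s) p0 Qp); first last.
- by move=> w; rewrite mule_ge0// ?lee_fin// expeR_ge0.
- apply: emeasurable_funM.
    by apply/measurable_EFinP; exact: measurable_indic.
  apply: measurableT_comp; first exact: measurable_expeR.
  by apply: measurableT_comp => //; exact: measurable_funeM.
rewrite (@serving_laplace _ _ _ P lambda c ell q thr tau (ell s r) lambda0 ell_ge0
  ell_nonincr mq q0 _ q_sum hP fad0 tau0 a0).
have mw v : measurable_fun (setT : set (measurableTypeR R * measurableTypeR R)%type)
    (fun x => (q v x * serving_weight ell thr tau (ell s r) v (dist x))%:E).
  apply/measurable_EFinP; apply: (@measurable_funM _ (R * R)%type); first exact: mq.
  exact: (measurable_serving_weight thr ell_ge0 ell_nonincr tau0 a0 v).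
have w0 v x : (0 <= (q v x * serving_weight ell thr tau (ell s r) v (dist x))%:E)%E.
  rewrite lee_fin mulr_ge0// /serving_weight; case: ifP => // _.
  by rewrite interf_factor_ge0// ell_ge0// dist_ge0.
under eq_integral do rewrite EFinD.
rewrite (ge0_integralD _ _ _ (mw true) _ (mw false))//.
rewrite ge0_muleDr; [|exact: integral_ge0|exact: integral_ge0].
rewrite !exponent// /serving_density.
rewrite -[kappa _ _ _ _ LoS _ _ _]/(expeR (- interf true)).
rewrite -[kappa _ _ _ _ NLoS _ _ _]/(expeR (- interf false)).
rewrite -/(void true) -/(void false) muleCA; congr (_ * _)%E.
rewrite -!expeRD; congr expeR.
move: (void true) (void false) (interf true) (interf false)
  (void_ge0 true) (void_ge0 false) (interf_ge0 true) (interf_ge0 false).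
move=> x y z t x0 y0 z0 t0.
(* The exponents may be [+oo]; nonnegativity rules out indeterminate sums. *)
have oppD (u v : \bar R) : (0 <= u)%E -> (0 <= v)%E -> (- (u + v) = - u - v)%E.
  by move=> u0 v0; rewrite oppeD// ge0_adde_def// inE.
rewrite !oppD ?adde_ge0//.
by rewrite addeACA [RHS]addeC.
Qed.
End fixed_distance.
End coverage_given_distance.

(** * From rate to SINR, and the integral over the distance *)

Lemma link_prob_gt0 (R : realType) (beta : R) s r : 0 < beta -> 0 < r ->
  0 < link_prob beta s r.
Proof.
move=> beta0 r0; rewrite /link_prob; case: s; first exact: expR_gt0.
by rewrite subr_gt0 -expR0 ltr_expR oppr_lt0 mulr_gt0.
Qed.

Lemma user_rate_gtE (R : realType) (B Nu rho x : R) : 0 < B -> 0 < Nu -> 0 < rho ->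
  (rho < user_rate (B / Nu) x) = (2 `^ (rho * Nu / B) - 1 < x).
Proof.
move=> B0 Nu0 rho0; rewrite /user_rate /log2.
have ln2 : 0 < ln 2 :> R by rewrite ln_gt0// ltr1n.
have k0 : 0 < rho * Nu / B by rewrite divr_gt0// mulr_gt0.
have powE : 2 `^ (rho * Nu / B) = expR (rho * Nu / B * ln 2).
  by rewrite /powR pnatr_eq0.
rewrite ltrBlDl powE; have [x1|x1] := ltP 0 (1 + x).
  rewrite -{2}(lnK (x := 1 + x)) ?posrE// ltr_expR.
  rewrite (_ : B / Nu * _ = ln (1 + x) / (Nu / B * ln 2)); last first.
    by field; rewrite !gt_eqF.
  by rewrite ltr_pdivlMr; [rewrite !mulrA|rewrite mulr_gt0// divr_gt0].
(* For [1 + x <= 0], [ln] takes its default value 0, so the rate is 0, below [rho]; the other side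
   fails because a power of 2 is positive. *)
rewrite ln0// mul0r mulr0; apply/idP/idP => h.
  by have := lt_trans rho0 h; rewrite ltxx.
have := lt_le_trans h x1; rewrite ltNge expR_ge0//.
Qed.

Theorem lemma9 (R : realType)
  (lambda mu sigma2 lambda_u B rho : R)
  (hlambda : 0 < lambda) (hmu : 0 < mu) (hsigma2 : 0 < sigma2)
  (hlambda_u : 0 <= lambda_u) (hB : 0 < B) (hrho : 0 < rho)
  (ell : bool -> R -> R)
  (ell_ge0 : forall v t, 0 <= t -> 0 <= ell v t)
  (ell_bounded : forall v, exists m, forall t, 0 <= t -> ell v t <= m)
  (ell_nonincr : forall v t1 t2, 0 <= t1 -> t1 <= t2 -> ell v t2 <= ell v t1)
  (ell_LN : forall t, 0 <= t -> ell NLoS t <= ell LoS t)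
  (len : probability R R)
  (len_ge0 : len [set l | l < 0] = 0%E)
  (len_mean : (0 < \int[len]_l l%:E < +oo)%E)
  (db : measure_display) (Tb : measurableType db) (Pb : probability Tb R)
  (b : blockages R Tb)
  (hb : is_boolean_model Pb mu len b)
  (d : measure_display) (T : measurableType d)
  (c : stations R T) (Q : R -> probability T R)
  (hQ : first_order_model lambda (link_prob (blockage_rate mu len))
          (joint_prob Pb b) c Q) :
  let Nu := mean_users lambda lambda_u in
  let Bu := B / Nu in
  let tau0 := 2 `^ (rho * Nu / B) - 1 in
  [/\ rate_coverage lambda ell sigma2 c Q Bu rho =
        fo_prob lambda ell sigma2 c Q [set x | rho < Bu * log2 (1 + x)],
      fo_prob lambda ell sigma2 c Q [set x | rho < Bu * log2 (1 + x)] =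
        fo_prob lambda ell sigma2 c Q [set x | tau0 < x],
      fo_prob lambda ell sigma2 c Q [set x | tau0 < x] =
        sinr_coverage lambda ell sigma2 c Q tau0
    & forall tau, 0 < tau ->
        sinr_coverage lambda ell sigma2 c Q tau =
        coverage_formula lambda ell sigma2 (link_prob (blockage_rate mu len))
          (joint_prob Pb b) tau].

Proof.
move=> Nu Bu tau0.
have Nu0 : 0 < Nu by rewrite /Nu /mean_users ltr_pwDl// mulr_ge0// divr_ge0// ltW.
(* The first and third equalities hold by unfolding; the second compares the two sets of SINR
   values. *)
split => //.
  congr (fo_prob _ _ _ _ _ _); apply/seteqP; split => x /=;
    by rewrite -[Bu * _]/(user_rate Bu x) user_rate_gtE.
move=> tau tau_gt0; rewrite /sinr_coverage /fo_prob /coverage_formula.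
set beta := blockage_rate mu len in hQ *.
(* The mean length is positive and finite, so [fine] keeps it positive. *)
have beta0 : 0 < beta.
  rewrite divr_gt0 ?pi_gt0// !mulr_gt0//; apply: fine_gt0.
  exact: len_mean.
apply: eq_bigr => s _.
have k0 : 0 < 2 * pi * lambda by rewrite !mulr_gt0// pi_gt0.
(* The integrand involves [Q r], about whose dependence on [r] nothing is assumed. *)
rewrite -ge0_integral_scale//; last first.
  move=> r; rewrite /= in_itv/= andbT => r0.
  by rewrite mule_ge0// lee_fin ltW.
apply: eq_integral => r /set_mem; rewrite /= in_itv/= andbT => r0.
rewrite (coverage_given_distance hlambda hsigma2 ell_ge0 ell_nonincr hQ r0 tau_gt0
  (link_prob_gt0 s beta0 r0)).
by rewrite EFinM !muleA.
Qed.
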